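(* Let $G=(A\cup B,E)$ be a bipartite matching covered graph. The following are equivalent: (1) $M$-$\operatorname{pmw}(G)=2$ for some $M\in\mathcal{M}(G)$; (2) $M$-$\operatorname{pmw}(G)=2$ for all $M\in\mathcal{M}(G)$; (3) every brace of $G$ is isomorphic either to $C_4$ or to $K_{3,3}$.
   Context: All graphs are finite and simple. $\mathcal{M}(G)$ is the set of perfect matchings of $G$; $G$ is matching covered if connected and every edge lies in a perfect matching. For nonempty $X\subseteq V(G)$, $\partial(X)$ is the set of edges with exactly one endpoint in $X$ (shores $X$ and $V(G)\setminus X$), and $\operatorname{mp}(\partial(X))=\max_{M\in\mathcal{M}(G)}|M\cap\partial(X)|$. A PM-decomposition of $G$ is a pair $(T,\delta)$ with $T$ a cubic tree (all non-leaf vertices of degree 3) and $\delta$ a bijection from the leaves of $T$ to $V(G)$; each edge $t_1t_2$ of $T$ splits the leaves into two sets whose $\delta$-images $X_1,X_2$ partition $V(G)$ and induces the cut $\partial(X_1)$; the width of $(T,\delta)$ is the maximum matching porosity of these cuts. For $M\in\mathcal{M}(G)$, a set $S\subseteq V(G)$ is $M$-conformal if the edges of $M$ with both ends in $S$ form a perfect matching of $G[S]$ and the edges of $M$ with both ends outside $S$ form a perfect matching of $G-S$. An $M$-PM-decomposition is a PM-decomposition such that for every edge of $T$ not incident with a leaf, both sets $X_1,X_2$ are $M$-conformal; $M$-$\operatorname{pmw}(G)$ is the minimum width of an $M$-PM-decomposition of $G$. A cut $\partial(Z)$ is tight if $|M\cap\partial(Z)|=1$ for all $M\in\mathcal{M}(G)$,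 nontrivial if both shores have at least two vertices. The $Z$-contraction of $G$ identifies $Z$ into a single vertex (deleting parallel edges). A brace is a bipartite matching covered graph with no nontrivial tight cut. The braces of $G$ are the bipartite graphs obtained by repeatedly replacing a graph having a nontrivial tight cut $\partial(Z)$ by its two contractions (of $Z$ and of its complement) until no nontrivial tight cut remains; this list is independent of the choices made. *)

(* Defs.v *)
From HB Require Import structures.
From mathcomp Require Import all_boot.
Set Implicit Arguments. Unset Strict Implicit. Unset Printing Implicit Defensive.

Record sgraph := SGraph {
  vertex :> finType;
  adj : rel vertex;
  adj_sym : symmetric adj;
  adj_irrefl : irreflexive adj }.
Arguments adj {s} : simpl never.

Section Graphs.
Variable G : sgraph.
Implicit Types (X S Z A B : {set G}) (M : {set {set G}}).

Definition edges : {set {set G}} :=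
  [set [set p.1; p.2] | p : G * G & adj p.1 p.2].

Definition connected := 0 < #|G| /\ forall x y : G, connect adj x y.

(* Closed walks of length 2 (back and forth along an edge) are also [ucycle]s,
   so a graph cycle is a [ucycle] of size at least 3. *)
Definition acyclic := forall c : seq G, ucycle (@adj G) c -> size c < 3.

Definition degree (x : G) := #|[set y | adj x y]|.
Definition leaf : {set G} := [set x | degree x == 1].

Definition cubic_tree :=
  [/\ connected, acyclic & forall x : G, x \notin leaf -> degree x = 3].

Definition bipartition A B :=
  [/\ A :|: B = setT, [disjoint A & B] &
      forall x y : G, adj x y -> (x \in A) = (y \in B)].

Definition bipartite := exists A B, bipartition A B.

(* The edge set of the induced subgraph G[S]. *)
Definition edges_in S : {set {set G}} := [set f in edges | f \subset S].

(* M is a perfect matching of the induced subgraph G[S]. *)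
Definition perfect_matching_on S M : bool :=
  (M \subset edges_in S) && [forall v in S, #|[set f in M | v \in f]| == 1].

Definition perfect_matchings : {set {set {set G}}} :=
  [set M | perfect_matching_on [set: G] M].

Definition matching_covered :=
  connected /\
  forall f, f \in edges -> exists2 M, M \in perfect_matchings & f \in M.

Definition cut X : {set {set G}} := [set f in edges | #|f :&: X| == 1].

Definition porosity X := \max_(M in perfect_matchings) #|M :&: cut X|.

Definition conformal M S :=
  perfect_matching_on S (M :&: edges_in S) &&
  perfect_matching_on (~: S) (M :&: edges_in (~: S)).

Definition tight Z := forall M, M \in perfect_matchings -> #|M :&: cut Z| = 1.

Definition nontrivial Z := 1 < #|Z| /\ 1 < #|~: Z|.

End Graphs.

Arguments edges G : clear implicits.
Arguments leaf G : clear implicits.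
Arguments perfect_matchings G : clear implicits.

(** ** Perfect matching decompositions *)

Record pm_decomposition (G : sgraph) := PMDecomposition {
  tree : sgraph;
  tree_cubic : cubic_tree tree;
  delta : {x : tree | x \in leaf tree} -> G;
  delta_bij : bijective delta }.

Section PMWidth.
Variables (G : sgraph) (D : pm_decomposition G).

Definition tree_minus (t1 t2 : tree D) : rel (tree D) :=
  fun x y => adj x y && ([set x; y] != [set t1; t2]).

(* The shore given by the component of T - t1t2 that contains t1; the opposite
   shore is [shore t2 t1]. *)
Definition shore (t1 t2 : tree D) : {set G} :=
  [set @delta G D l | l : {x : tree D | x \in leaf (tree D)}
                    & connect (tree_minus t1 t2) t1 (val l)].

Definition width :=
  \max_(t : tree D * tree D | adj t.1 t.2) porosity (shore t.1 t.2).

Definition M_decomposition (M : {set {set G}}) :=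
  forall t1 t2 : tree D, adj t1 t2 -> t1 \notin leaf _ -> t2 \notin leaf _ ->
    conformal M (shore t1 t2) /\ conformal M (shore t2 t1).

End PMWidth.

(* M-pmw(G) = k *)
Definition M_pmw_eq (G : sgraph) (M : {set {set G}}) (k : nat) :=
  (exists2 D : pm_decomposition G, M_decomposition D M & width D = k) /\
  (forall D : pm_decomposition G, M_decomposition D M -> k <= width D).

(** ** Tight cut contractions and braces *)

Section Contraction.
Variables (G : sgraph) (Z : {set G}).

(* [None] is the vertex into which Z is identified. *)
Definition contract_adj : rel (option {x : G | x \notin Z}) := fun u v =>
  match u, v with
  | Some x, Some y => adj (val x) (val y)
  | Some x, None => [exists z in Z, adj (val x) z]
  | None, Some y => [exists z in Z, adj z (val y)]
  | None, None => false
  end.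

Lemma contract_adj_sym : symmetric contract_adj.
Proof.
by move=> [x|] [y|] //=; rewrite 1?adj_sym //; apply: eq_existsb => z;
  rewrite adj_sym.
Qed.

Lemma contract_adj_irrefl : irreflexive contract_adj.
Proof. by case=> [x|] //=; rewrite adj_irrefl. Qed.

Definition contraction := SGraph contract_adj_sym contract_adj_irrefl.

End Contraction.

(* [brace_of G H]: H is one of the graphs produced from G by some maximal
   sequence of tight cut contractions. *)
Inductive brace_of : sgraph -> sgraph -> Prop :=
| brace_of_self (G : sgraph) :
    bipartite G -> (forall Z : {set G}, nontrivial Z -> ~ tight Z) ->
    brace_of G G
| brace_of_contract (G H : sgraph) (Z : {set G}) :
    nontrivial Z -> tight Z -> brace_of (contraction Z) H -> brace_of G H
| brace_of_contractC (G H : sgraph) (Z : {set G}) :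
    nontrivial Z -> tight Z -> brace_of (contraction (~: Z)) H -> brace_of G H.

Definition isomorphic (G H : sgraph) :=
  exists2 f : G -> H, bijective f & forall x y, adj (f x) (f y) = adj x y.

Definition C4_adj : rel 'I_4 :=
  fun i j => (i.+1 == j %[mod 4]) || (j.+1 == i %[mod 4]).

Lemma C4_adj_sym : symmetric C4_adj.
Proof. by move=> i j; rewrite /C4_adj orbC. Qed.

Lemma C4_adj_irrefl : irreflexive C4_adj.
Proof. by case=> [[|[|[|[|i]]]] ?]. Qed.

Definition C4 := SGraph C4_adj_sym C4_adj_irrefl.

Definition K33_adj : rel (bool * 'I_3) := fun u v => u.1 != v.1.

Lemma K33_adj_sym : symmetric K33_adj.
Proof. by move=> u v; rewrite /K33_adj eq_sym. Qed.

Lemma K33_adj_irrefl : irreflexive K33_adj.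
Proof. by move=> u; rewrite /K33_adj eqxx. Qed.

Definition K33 := SGraph K33_adj_sym K33_adj_irrefl.

(* Main.v *)
Require Import Defs.
From HB Require Import structures.
From mathcomp Require Import all_boot.
From mathcomp Require Import zify.
Set Implicit Arguments. Unset Strict Implicit. Unset Printing Implicit Defensive.

(** A perfect matching is handled as an involution [m] with [adj x (m x)]; an
    [M]-conformal set is an [m]-stable one, and for such a set the edges of a
    matching that cross it are split evenly between the two colours.

    From width to braces: in a cubic tree every set of at least four leaves is
    split into two parts of size at least two by some inner edge, so a
    decomposition of width two yields, for every set [W] of at least four
    vertices, a stable set that splits [W] and is crossed at most twice by every
    perfect matching.  This property passes to tight cut contractions: among the
    two colours of crossing edges, one avoids the contracted vertex.  In a brace
    with colour classes of size at least four it fails, since Hall's theorem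
    makes any two disjoint edges extend to a perfect matching, and a stable set
    with at least two vertices of each colour on both sides has two disjoint
    edges leaving it from one colour.

    From braces to width: by induction along tight cuts, for every edge [xy] of
    the matching the complement of [{x, y}] is obtained from matching edges by
    disjoint unions, each of which is crossed at most twice.  A decomposition of a
    contraction is pulled back by replacing the leaf edge at the contracted
    vertex with a decomposition of the other contraction.  The sets so obtained
    form a laminar family, and its covering relation is the required tree. *)

(** * Perfect matchings as involutions *)

Section Matchings.
Variable G : sgraph.
Implicit Types (x y : G) (X Z A : {set G}) (m : G -> G) (M : {set {set G}}).

Definition matching m := (forall x, adj x (m x)) /\ involutive m.

Definition matching_edges m : {set {set G}} := [set [set x; m x] | x : G].

(** A crossing edge is recorded by its end inside [X], so that crossing edges can be counted by the
    colour of that end. *)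
Definition crossing m X := [set x in X | m x \notin X].

Definition coloring A := forall x y, adj x y -> (y \in A) = (x \notin A).

Definition edge_covered :=
  forall x y, adj x y -> exists2 m, matching m & m x = y.

Definition stable m X := forall x, (m x \in X) = (x \in X).

Definition thin X := forall m, matching m -> #|crossing m X| <= 2.

Lemma matching_neq m x : matching m -> m x != x.
Proof.
by case=> adjm _; apply/eqP => e; have := adjm x; rewrite e adj_irrefl.
Qed.

Lemma set2_eq (T : finType) (a b c d : T) : [set a; b] = [set c; d] ->
  (a = c /\ b = d) \/ (a = d /\ b = c).
Proof.
move=> e.
have : a \in [set c; d] by rewrite -e set21.
have : b \in [set c; d] by rewrite -e set22.
have : c \in [set a; b] by rewrite e set21.
have : d \in [set a; b] by rewrite e set22.
rewrite !inE => /orP[] /eqP ? /orP[] /eqP ? /orP[] /eqP ? /orP[] /eqP ?.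
all: by subst; auto.
Qed.

Lemma edgesP x y : ([set x; y] \in edges G) = adj x y.
Proof.
apply/imsetP/idP => [[[u v]] | h].
  rewrite inE /= => h /set2_eq [] [-> ->] //; by rewrite adj_sym.
by exists (x, y); rewrite ?inE.
Qed.

Lemma edge_of_matching m x f : matching m ->
  (f \in matching_edges m) && (x \in f) = (f == [set x; m x]).
Proof.
case=> _ mK; apply/andP/eqP => [[/imsetP[y _ ->]] | ->].
  by rewrite !inE => /orP[] /eqP ->; rewrite ?mK 1?setUC.
by rewrite set21; split=> //; apply/imsetP; exists x.
Qed.

Lemma matching_edges_pm m :
  matching m -> matching_edges m \in perfect_matchings G.
Proof.
move=> mm; rewrite inE; apply/andP; split.
  apply/subsetP => f /imsetP[x _ ->]; rewrite inE edgesP subsetT andbT.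
  by case: mm.
apply/forallP => x; apply/implyP => _.
rewrite (_ : [set _ in _ | _] = [set [set x; m x]]) ?cards1 //.
by apply/setP => f; rewrite !inE edge_of_matching.
Qed.

(** Every [x] lies in exactly one edge of [M]; sending [x] to the other end is an involution because
    that edge is also the edge of its mate. *)
Lemma pm_matching M : M \in perfect_matchings G ->
  exists2 m, matching m & M = matching_edges m.
Proof.
rewrite inE => /andP[/subsetP sM /forallP uM].
have M1 x : exists2 y, adj x y & forall f, (f \in M) && (x \in f) = (f == [set x; y]).
  have /cards1P[f ef] := implyP (uM x) (in_setT x).
  have ef' g : (g \in M) && (x \in g) = (g == f).
    by move/setP/(_ g): ef; rewrite !inE.
  have /andP[/sM] : (f \in M) && (x \in f) by rewrite ef'.
  rewrite inE => /andP[/imsetP[[u v]]]; rewrite inE /= => auv ef0 _.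
  rewrite ef0 !inE => /orP[] /eqP ?; subst x.
    by exists v => // g; rewrite ef' ef0.
  by exists u => [|g]; [rewrite adj_sym | rewrite ef' ef0 setUC].
have /fin_all_exists2[m adjm Mm] := M1.
have mK : involutive m.
  move=> x; have := Mm (m x) [set x; m x].
  rewrite set22 andbT.
  have := Mm x [set x; m x]; rewrite eqxx set21 andbT => -> /esym/eqP.
  by case/set2_eq => [[e <-] | [<- _]].
exists m => //; apply/setP => f; apply/idP/imsetP => [fM | [x _ ->]].
  have := sM _ fM; rewrite inE => /andP[/imsetP[[u v] _ ef] _].
  exists u => //; apply/eqP; rewrite -Mm fM ef set21 //.
by have := Mm x [set x; m x]; rewrite eqxx => /andP[].
Qed.

(** Sending [x] to its matching edge is injective on crossing vertices, since the other end of the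
    edge lies outside [X]. *)
Lemma card_cut m X : matching m ->
  #|matching_edges m :&: cut X| = #|crossing m X|.
Proof.
move=> mm; have [adjm mK] := mm.
have cutE x : ([set x; m x] \in cut X) = (x \in X) (+) (m x \in X).
  rewrite inE edgesP adjm /= setIUl cardsU.
  have c1 y : #|[set y] :&: X| = (y \in X).
    case: (boolP (y \in X)) => yX; first by rewrite (setIidPl _) ?cards1 ?sub1set.
    by rewrite disjoint_setI0 ?cards0 // disjoints1.
  rewrite !c1 (_ : _ :&: _ = set0) ?cards0 ?subn0.
    by do 2! case: (_ \in X).
  apply/setP => t; rewrite !inE; case: (t =P x) => [->|] //=.
  by rewrite eq_sym (negPf (matching_neq x mm)) andbF.
have inj : {in crossing m X &, injective (fun x => [set x; m x])}.
  move=> x y; rewrite !inE => /andP[xX _] /andP[_ myX] /set2_eq [[]|[e _]] //.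
  by rewrite e (negPf myX) in xX.
rewrite -(card_in_imset inj); apply: eq_card => f.
apply/setIP/imsetP => [[/imsetP[x _ ->]] | [x]].
  rewrite cutE; case: (boolP (x \in X)) => xX /= mxX.
    by exists x; rewrite ?inE ?xX.
  by exists (m x); rewrite ?inE ?mK ?mxX // setUC.
rewrite inE => /andP[xX mxX] ->; rewrite cutE xX (negPf mxX); split=> //.
by apply/imsetP; exists x.
Qed.

Lemma tightP Z : tight Z <-> forall m, matching m -> #|crossing m Z| = 1.
Proof.
split=> [tZ m mm | tZ M /pm_matching[m mm ->]]; last by rewrite card_cut ?tZ.
by rewrite -card_cut // tZ // matching_edges_pm.
Qed.

Lemma porosity_leqP X k :
  porosity X <= k <-> forall m, matching m -> #|crossing m X| <= k.
Proof.
split=> [/bigmax_leqP pX m mm | pX].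
  by rewrite -card_cut // pX // matching_edges_pm.
by apply/bigmax_leqP => M /pm_matching[m mm ->]; rewrite card_cut // pX.
Qed.

(** The restriction of the matching to [S] covers [x] exactly when [m x] lies in [S], so each half
    of conformality says that [m] maps one of the two shores into itself. *)
Lemma conformalP m X : matching m ->
  reflect (stable m X) (conformal (matching_edges m) X).
Proof.
move=> mm; have [adjm mK] := mm.
have pmE S : perfect_matching_on S (matching_edges m :&: edges_in S) =
             [forall x in S, m x \in S].
  rewrite /perfect_matching_on subsetIr /=.
  apply: eq_forallb => x; case: (boolP (x \in S)) => //= xS.
  rewrite (_ : [set _ in _ | _] =
    if m x \in S then [set [set x; m x]] else set0).
    by case: ifP; rewrite ?cards1 ?cards0.
  apply/setP => f; rewrite inE in_setI andbAC edge_of_matching // inE.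
  have -> : (f == [set x; m x]) && ((f \in edges G) && (f \subset S)) =
            (f == [set x; m x]) && (m x \in S).
    case: eqP => // ->.
    by rewrite edgesP adjm subUset !sub1set xS.
  by case: ifP; rewrite !inE ?andbT ?andbF.
rewrite /conformal !pmE; apply: (iffP andP).
  case=> /forall_inP sX /forall_inP sXC x; apply/idP/idP => [|/sX//].
  apply: contraLR => xX; have := sXC x; rewrite !inE; exact.
by move=> sX; split; apply/forall_inP => x; rewrite ?inE sX.
Qed.

End Matchings.

(** * Crossing edges and colour classes *)

Section Crossing.
Variable G : sgraph.
Implicit Types (x y : G) (X Z A : {set G}) (m : G -> G).

Lemma card_crossingC m X : matching m -> #|crossing m (~: X)| = #|crossing m X|.
Proof.
move=> [_ mK]; rewrite -(card_imset _ (inv_inj mK)); apply: eq_card => x.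
apply/imsetP/idP => [[y] | ].
  by rewrite !inE negbK => /andP[yX myX] ->; rewrite mK myX.
by rewrite inE => /andP[xX mxX]; exists (m x); rewrite ?inE ?mK // mxX negbK.
Qed.

Lemma card_crossing_leq m X : #|crossing m X| <= #|X|.
Proof. by apply: subset_leq_card; apply/subsetP => x; rewrite inE => /andP[]. Qed.

Lemma thin_small X : #|X| <= 2 -> thin X.
Proof. by move=> X2 m _; apply: leq_trans X2; apply: card_crossing_leq. Qed.

Lemma thinC X : thin X -> thin (~: X).
Proof. by move=> tX m mm; rewrite card_crossingC // tX. Qed.

Lemma tightC Z : tight Z -> tight (~: Z).
Proof.
by move=> /tightP tZ; apply/tightP => m mm; rewrite card_crossingC ?tZ.
Qed.

Lemma nontrivialC Z : nontrivial Z -> nontrivial (~: Z).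
Proof. by rewrite /nontrivial setCK => -[]. Qed.

Lemma stableC m X : stable m X -> stable m (~: X).
Proof. by move=> sX x; rewrite !inE sX. Qed.

Lemma stableU m X Y : stable m X -> stable m Y -> stable m (X :|: Y).
Proof. by move=> sX sY x; rewrite !inE sX sY. Qed.

Lemma stable_pair m x : matching m -> stable m [set x; m x].
Proof.
move=> [_ mK] y; rewrite !inE (inv_eq mK) orbC; congr (_ || _).
exact: inj_eq (inv_inj mK) _ _.
Qed.

Lemma stable_crossing m X : stable m X -> crossing m X = set0.
Proof. by move=> sX; apply/setP => x; rewrite !inE sX andbN. Qed.

Lemma coloringC A : coloring A -> coloring (~: A).
Proof. by move=> cA x y axy; rewrite !inE (cA x y). Qed.

(** The matching edges inside [X] pair the non-crossing vertices of one colour with those of the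
    other, so any surplus of a colour in [X] comes from crossing vertices. *)
Lemma crossing_balance m A X : matching m -> coloring A ->
  #|X :&: A| + #|crossing m X :\: A| = #|X :\: A| + #|crossing m X :&: A|.
Proof.
move=> [adjm mK] cA.
have cm x : (m x \in A) = (x \notin A) by apply: cA.
pose I := X :\: crossing m X.
have IE x : (x \in I) = (x \in X) && (m x \in X).
  by rewrite !inE; case: (x \in X); rewrite ?andbF ?andbT // negbK.
have split (S : {set G}) : #|X :&: S| = #|crossing m X :&: S| + #|I :&: S|.
  rewrite -(cardsID (crossing m X) (X :&: S)); congr (_ + _); apply: eq_card => x.
    by rewrite !inE; case: (x \in X); case: (x \in S); rewrite ?andbF ?andbT.
  by rewrite !inE; case: (x \in X); case: (x \in S);
    rewrite ?andbF ?andbT //= negbK.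
have -> : X :\: A = X :&: ~: A by rewrite setDE.
have -> : crossing m X :\: A = crossing m X :&: ~: A by rewrite setDE.
rewrite !split.
have -> : #|I :&: ~: A| = #|I :&: A|; last by lia.
rewrite -(card_imset _ (inv_inj mK)); apply: eq_card => x.
apply/imsetP/idP => [[y] | ].
  by rewrite !(IE, inE) => /andP[/andP[yX myX] yA] ->; rewrite mK myX yX cm.
rewrite in_setI IE => /andP[/andP[xX mxX] xA]; exists (m x); last by rewrite mK.
by rewrite in_setI IE mK mxX xX inE cm negbK.
Qed.

Lemma card_stable m A X : matching m -> coloring A -> stable m X ->
  #|X :\: A| = #|X :&: A|.
Proof.
move=> mm cA sX; have := crossing_balance X mm cA.
by rewrite stable_crossing // set0D set0I cards0 !addn0.
Qed.

Lemma card_coloring m A : matching m -> coloring A -> #|~: A| = #|A|.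
Proof.
move=> mm cA; have := @card_stable m A setT mm cA.
by rewrite setTD setTI; apply=> x; rewrite !inE.
Qed.

(** Stability under [m0] makes both colours equally frequent in [X]; the balance for [m] makes them
    equally frequent among its crossing vertices. In particular the number of crossing edges is
    even. *)
Lemma card_crossing_half m0 m A X :
  matching m0 -> stable m0 X -> matching m -> coloring A ->
  #|crossing m X| = (#|crossing m X :&: A|).*2.
Proof.
move=> mm0 sX mm cA; have := crossing_balance X mm cA.
rewrite (card_stable mm0 cA sX) => /addnI e.
by rewrite -(cardsID A (crossing m X)) e addnn.
Qed.

(** By the balance, the single crossing vertex has the colour in excess in [Z]. The right-hand side
    is independent of the edge, so all edges leaving [Z] start at the same colour. *)
Lemma tight_color Z A x y : tight Z -> edge_covered G -> coloring A ->
  adj x y -> x \in Z -> y \notin Z -> (x \in A) = (#|Z :\: A| < #|Z :&: A|).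
Proof.
move=> /tightP tZ ec cA axy xZ yZ; have [m mm mx] := ec _ _ axy.
have /eqP/cards1P[z ez] := tZ _ mm.
have : x \in crossing m Z by rewrite inE xZ mx.
rewrite ez inE => /eqP ?; subst z.
have := crossing_balance Z mm cA; rewrite ez.
case: (boolP (x \in A)) => xA.
  have -> : [set x] :\: A = set0 by apply/eqP; rewrite setD_eq0 sub1set.
  have -> : [set x] :&: A = [set x] by apply/setIidPl; rewrite sub1set.
  by rewrite cards0 cards1; lia.
have -> : [set x] :\: A = [set x] by apply/setDidPl; rewrite disjoints1.
have -> : [set x] :&: A = set0 by apply: disjoint_setI0; rewrite disjoints1.
by rewrite cards0 cards1; lia.
Qed.

End Crossing.

(** * Tight cut contractions *)

Section Projection.
Variables (G : sgraph) (Z : {set G}).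
Implicit Types (x y : G) (u v : contraction Z) (m : G -> G).

Definition proj x : contraction Z := insub x.

Lemma proj_out x (xZ : x \notin Z) : proj x = Some (exist _ x xZ).
Proof. exact: insubT. Qed.

Lemma proj_in x : x \in Z -> proj x = None.
Proof. by move=> xZ; apply: insubF; rewrite xZ. Qed.

Lemma proj_val (a : {x : G | x \notin Z}) : proj (val a) = Some a.
Proof. exact: valK. Qed.

Lemma proj_eqNone x : (proj x == None) = (x \in Z).
Proof.
by case: (boolP (x \in Z)) => xZ; [rewrite proj_in | rewrite (proj_out xZ)].
Qed.

Lemma proj_eq x y : proj x = proj y -> x = y \/ x \in Z /\ y \in Z.
Proof.
case: (boolP (x \in Z)) => xZ; case: (boolP (y \in Z)) => yZ.
- by right.
- by rewrite (proj_in xZ) (proj_out yZ).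
- by rewrite (proj_in yZ) (proj_out xZ).
- by rewrite (proj_out xZ) (proj_out yZ) => -[]; left.
Qed.

Lemma adj_proj x y : adj x y -> ~~ ((x \in Z) && (y \in Z)) ->
  adj (proj x) (proj y).
Proof.
move=> axy; case: (boolP (x \in Z)) => xZ; case: (boolP (y \in Z)) => yZ //= _.
- by rewrite (proj_in xZ) (proj_out yZ); apply/existsP; exists x; rewrite xZ.
- by rewrite (proj_in yZ) (proj_out xZ); apply/existsP; exists y; rewrite yZ.
- by rewrite (proj_out xZ) (proj_out yZ).
Qed.

Lemma adj_lift u v : adj u v -> exists x y, [/\ proj x = u, proj y = v & adj x y].
Proof.
case: u v => [a|] [b|] //.
- by move=> ab; exists (val a), (val b); rewrite !proj_val.
- move=> /existsP[z /andP[zZ az]]; exists (val a), z.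
  by rewrite proj_val proj_in.
- move=> /existsP[z /andP[zZ az]]; exists z, (val b).
  by rewrite proj_val proj_in.
Qed.

(** An edge of [m] inside [Z] has no image in the contraction, hence the exclusion. *)
Definition compatible m (m1 : contraction Z -> contraction Z) :=
  forall x, ~~ ((x \in Z) && (m x \in Z)) -> m1 (proj x) = proj (m x).

Section Representative.
Variable z : G.

(** A section of [proj] in which [z] represents the contracted vertex. When [z] is the end in [Z] of
    the only edge of [m] leaving [Z], it transports [m] to the contraction. *)
Definition vrep u : G := if u is Some a then val a else z.

Lemma vrepK u : z \in Z -> proj (vrep u) = u.
Proof. by case: u => [a|] zZ /=; rewrite ?proj_val ?proj_in. Qed.

Lemma vrep_proj_out x : x \notin Z -> vrep (proj x) = x.
Proof. by move=> xZ; rewrite (proj_out xZ). Qed.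

Variables (m : G -> G) (mm : matching m) (crossz : crossing m Z = [set z]).

Definition proj_matching u := proj (m (vrep u)).

Lemma crossz_in : z \in Z.
Proof. by have := set11 z; rewrite -crossz inE => /andP[]. Qed.

Lemma crossz_out : m z \notin Z.
Proof. by have := set11 z; rewrite -crossz inE => /andP[]. Qed.

Lemma crossz_eq x : x \in Z -> m x \notin Z -> x = z.
Proof. by move=> xZ mxZ; apply/set1P; rewrite -crossz inE xZ. Qed.

Lemma vrep_free u : ~~ ((vrep u \in Z) && (m (vrep u) \in Z)).
Proof.
case: u => [[a aZ]|] /=; first by rewrite (negPf aZ).
by rewrite (negPf crossz_out) andbF.
Qed.

Lemma vrep_proj x : ~~ ((x \in Z) && (m x \in Z)) -> vrep (proj x) = x.
Proof.
case: (boolP (x \in Z)) => xZ; last by rewrite vrep_proj_out.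
by move=> /(crossz_eq xZ) ->; rewrite proj_in ?crossz_in.
Qed.

Lemma vrep_proj_matching u : vrep (proj_matching u) = m (vrep u).
Proof. by apply: vrep_proj; rewrite (proj2 mm) andbC vrep_free. Qed.

Lemma proj_matchingP : matching proj_matching.
Proof.
split=> u; last by rewrite {1}/proj_matching vrep_proj_matching (proj2 mm)
  vrepK ?crossz_in.
rewrite -{1}(vrepK u crossz_in); apply: adj_proj (vrep_free u).
by case: mm.
Qed.

Lemma proj_matching_compatible : compatible m proj_matching.
Proof. by move=> x fx; rewrite /proj_matching vrep_proj. Qed.

End Representative.

(** [proj] is injective on crossing vertices: two of them with the same image would lie in [Z] with
    their mates outside, against the bound on [crossing m Z]. *)
Lemma crossing_proj m (m1 : contraction Z -> contraction Z) (X : {set contraction Z}) :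
  #|crossing m Z| <= 1 -> compatible m m1 ->
  #|crossing m (proj @^-1: X)| <= #|crossing m1 X|.
Proof.
move=> /card_le1_eqP cZ cm.
have free x : x \in crossing m (proj @^-1: X) -> ~~ ((x \in Z) && (m x \in Z)).
  rewrite !inE => /andP[xX]; apply: contra => /andP[xZ mxZ].
  by rewrite (proj_in mxZ) -(proj_in xZ).
rewrite -(card_in_imset (f := proj)).
  apply: subset_leq_card; apply/subsetP => _ /imsetP[x cx ->].
  have := cx; rewrite !inE => /andP[xX mxX].
  by rewrite xX cm // free.
move=> x y cx cy /proj_eq[//|[xZ yZ]]; have := free _ cx; have := free _ cy.
rewrite xZ yZ /= => myZ mxZ; apply: cZ; rewrite inE ?xZ ?yZ //.
Qed.

(** The edge of [m1] at the contracted vertex comes from an edge leaving [Z], and some matching [m']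
    contains that edge. By tightness [m'] matches the rest of [Z] within [Z], so [m'] on [Z] and
    [m1] elsewhere fit together. *)
Lemma lift_matching (m1 : contraction Z -> contraction Z) :
  edge_covered G -> tight Z -> matching m1 ->
  exists2 m, matching m & compatible m m1.
Proof.
move=> ec /tightP tZ [adjm1 m1K].
have := adjm1 None; case em1: (m1 None) => [y|] // /existsP[z /andP[zZ azy]].
have [m' mm' m'z] := ec _ _ azy; have [adjm' m'K] := mm'.
have yZ := valP y.
have crossz : crossing m' Z = [set z].
  have /eqP/cards1P[t et] := tZ _ mm'; rewrite et; congr [set _].
  by apply/esym/set1P; rewrite -et inE zZ m'z.
pose m x := if x \in Z then m' x else vrep z (m1 (proj x)).
have my x : x \notin Z -> m1 (proj x) = None -> x = val y.
  move=> xZ e; have := m1K (proj x); rewrite e em1 (proj_out xZ).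
  by case=> ->.
exists m; first split.
- move=> x; rewrite /m; case: (boolP (x \in Z)) => xZ //.
  case e: (m1 (proj x)) => [b|] /=.
    by have := adjm1 (proj x); rewrite e (proj_out xZ).
  by rewrite (my _ xZ e) adj_sym.
- move=> x; rewrite /m; case: (boolP (x \in Z)) => xZ.
    case: (boolP (m' x \in Z)) => m'xZ; first by rewrite m'K.
    have -> := crossz_eq crossz xZ m'xZ.
    by rewrite m'z proj_val -em1 m1K.
  case e: (m1 (proj x)) => [b|] /=; first
    by rewrite (negPf (valP b)) proj_val -e m1K vrep_proj_out.
  by rewrite zZ m'z (my _ xZ e).
move=> x; rewrite /m; case: (boolP (x \in Z)) => xZ /= mxZ.
  have -> := crossz_eq crossz xZ mxZ.
  by rewrite m'z proj_in // proj_val.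
by rewrite vrepK.
Qed.

Lemma card_contraction : #|contraction Z| = #|~: Z|.+1.
Proof.
rewrite card_option card_sig; congr _.+1.
by apply: eq_card => x; rewrite !inE.
Qed.

Hypotheses (conG : connected G) (ecG : edge_covered G) (tZ : tight Z)
  (Z0 : exists z, z \in Z).

Lemma contraction_connected : connected (contraction Z).
Proof.
split; first by rewrite card_contraction.
have [z zZ] := Z0 => u v.
rewrite -(vrepK u zZ) -(vrepK v zZ).
have /connectP[p pp ->] := proj2 conG (vrep z u) (vrep z v).
elim: p (vrep z u) pp => //= y p IH x /andP[axy /IH]; apply: connect_trans.
case: (boolP ((x \in Z) && (y \in Z))) => [/andP[xZ yZ] | fxy].
  by rewrite !proj_in.
exact/connect1/adj_proj.
Qed.

Lemma contraction_covered : edge_covered (contraction Z).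
Proof.
move=> u v auv; have [x [y [eu ev axy]]] := adj_lift auv.
have [m mm mxy] := ecG axy.
have /eqP/cards1P[z crossz] := proj1 (tightP Z) tZ _ mm.
exists (proj_matching z m); first exact: proj_matchingP.
rewrite -eu (proj_matching_compatible crossz) ?mxy //.
apply/negP => /andP[xZ yZ]; move: auv.
by rewrite -eu -ev !proj_in // adj_irrefl.
Qed.

(** The contracted vertex receives the colour in excess in [Z]; for a tight [Z] this is the colour
    of the end in [Z] of every edge leaving [Z]. *)
Definition proj_color (A : {set G}) : {set contraction Z} :=
  [set u | if u is Some a then val a \in A else #|Z :\: A| < #|Z :&: A|].

Lemma contraction_coloring A : coloring A -> coloring (proj_color A).
Proof.
move=> cA [a|] [b|] //; rewrite !inE.
- exact: cA.
- move=> /existsP[z /andP[zZ az]].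
  rewrite -(tight_color tZ ecG cA _ zZ (valP a)); first exact: cA.
  by rewrite adj_sym.
- move=> /existsP[z /andP[zZ az]].
  by rewrite -(tight_color tZ ecG cA _ zZ (valP b)) // (cA _ _ az).
Qed.

End Projection.

(** * A splitting property and its passage to contractions *)

Definition splittable (G : sgraph) := exists2 m : G -> G, matching m &
  forall W : {set G}, 4 <= #|W| ->
  exists X : {set G}, [/\ stable m X, thin X, 2 <= #|W :&: X| & 2 <= #|W :\: X|].

(** The set splitting the lift of [W] is pulled back along [vrep]. Both crossing counts are twice
    the count of one colour, so it suffices to compare a colour whose crossing edges avoid the
    contracted vertex. *)
Lemma splittable_contraction (G : sgraph) (Z A : {set G}) :
  edge_covered G -> coloring A -> tight Z -> splittable G ->
  splittable (contraction Z).
Proof.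
move=> ec cA tZ [m mm spl].
have /eqP/cards1P[z crossz] := proj1 (tightP Z) tZ _ mm.
have zZ := crossz_in crossz.
have rI : injective (@vrep G Z z) by apply: can_inj (fun u => vrepK u zZ).
exists (proj_matching z m) => [|W W4]; first exact: proj_matchingP.
have := spl (vrep z @: W); rewrite card_imset // => /(_ W4) [X [sX tX WX WXC]].
pose X1 : {set contraction Z} := vrep z @^-1: X.
have sX1 : stable (proj_matching z m) X1.
  by move=> u; rewrite !inE vrep_proj_matching // sX.
exists X1; split=> //; last first.
- apply: leq_trans WXC _; rewrite -(card_imset _ rI) subset_leq_card //.
  apply/subsetP => _ /setDP[/imsetP[u uW ->] uX].
  by apply/imsetP; exists u; rewrite ?inE ?uX.
- apply: leq_trans WX _; rewrite -(card_imset _ rI) subset_leq_card //.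
  apply/subsetP => _ /setIP[/imsetP[u uW ->] uX].
  by apply/imsetP; exists u; rewrite ?inE ?uW.
move=> m1 mm1; have [m' mm' cm'] := lift_matching ec tZ mm1.
have cA1 := contraction_coloring ec tZ cA.
(* [C1] contains [None] exactly when [X1] does not. A counted vertex lies in both [C1] and [X1], its
   mate in neither, so neither of them is [None]. *)
have [C [C1 [cC cC1 CE CN]]] : exists (C : {set G}) (C1 : {set contraction Z}),
  [/\ coloring C, coloring C1, forall a, (Some a \in C1) = (val a \in C) &
      (None \in C1) = (None \notin X1)].
  case: (boolP ((None \in proj_color Z A) == (None \notin X1))) => [/eqP|] e.
    by exists A, (proj_color Z A); split=> // a; rewrite inE.
  exists (~: A), (~: proj_color Z A); split=> [||a|]; try exact: coloringC.
    by rewrite !inE.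
  by rewrite inE; case: (_ \in _) e; case: (_ \in X1).
rewrite (card_crossing_half (proj_matchingP mm crossz) sX1 mm1 cC1).
apply: leq_trans (tX _ mm'); rewrite (card_crossing_half mm sX mm' cC) leq_double.
rewrite -(card_imset _ rI) subset_leq_card //.
(* With this choice of colour no counted edge meets the contracted vertex. *)
apply/subsetP => _ /imsetP[u + ->]; rewrite in_setI inE => /andP[/andP[uX m1uX] uC].
have := cC1 _ _ (proj1 mm1 u); rewrite uC /=.
case: u uX uC m1uX => [a|] uX uC; last by move: CN; rewrite uC uX.
case e: (m1 (Some a)) => [b|] bX bC; last by move: CN; rewrite bC bX.
have := cm' (val a); rewrite (negPf (valP a)) proj_val e => /(_ isT) eb.
have mb : m' (val a) = val b.
  have := proj_eq (etrans (proj_val b) eb).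
  by case=> [->|[]] //; rewrite (negPf (valP b)).
by move: uX bX; rewrite !inE /= mb => -> ->; rewrite -CE.
Qed.

(** * Hall's theorem and braces *)

Section Hall.
Variables (T U : finType).
Implicit Types (N : T -> {set U}) (D S : {set T}).

Definition hall N D := [forall S : {set T}, (S \subset D) ==>
  (#|S| <= #|\bigcup_(x in S) N x|)].

(** If both erasures failed, the violating sets would be too small for Hall's condition on their
    union and intersection, by submodularity of the cardinality: [a] is counted in the union but not
    in [S :&: S'], which gives the strict inequality. *)
Lemma hall_erase N D a y y' : a \in D -> y \in N a -> y' \in N a -> y != y' ->
  hall N D -> hall [eta N with a |-> N a :\ y] D || hall [eta N with a |-> N a :\ y'] D.
Proof.
move=> aD ya y'a yy' /forallP hN.
pose N' t : T -> {set U} := [eta N with a |-> N a :\ t].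
(* A violating set contains [a], since the other sets [N x] are unchanged; [S] is what remains of it
   without [a]. *)
have bad t : ~~ hall (N' t) D -> exists S, [/\ S \subset D, a \notin S &
    #|(N a :\ t) :|: \bigcup_(x in S) N x| <= #|S|].
  rewrite negb_forall => /existsP[S]; rewrite negb_imply -ltnNge => /andP[SD].
  have eqN (S' : {set T}) : a \notin S' ->
      \bigcup_(x in S') N' t x = \bigcup_(x in S') N x.
    move=> aS; apply: eq_bigr => x xS; rewrite /N' /=.
    by case: eqP => // e; rewrite -e xS in aS.
  case: (boolP (a \in S)) => aS; last first.
    by rewrite eqN //; have := hN S; rewrite SD /= leqNgt => /negPf ->.
  rewrite (big_setD1 a) //= {1}/N' /= eqxx eqN; last by rewrite !inE eqxx.
  rewrite [#|S|](cardsD1 a) aS add1n ltnS => le.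
  by exists (S :\ a); rewrite !inE eqxx (subset_trans _ SD) ?subD1set.
rewrite -[X in X || _]negbK -[X in _ || X]negbK -negb_and; apply/negP.
case/andP=> /bad[S [SD aS leS]] /bad[S' [S'D aS' leS']].
have := hN (a |: (S :|: S')); rewrite !subUset sub1set aD SD S'D /=.
rewrite cardsU1 inE negb_or aS aS' add1n.
have := hN (S :&: S'); rewrite (subset_trans (subsetIl _ _) SD) /=.
set P := (N a :\ y) :|: _ in leS; set P' := (N a :\ y') :|: _ in leS' => leI leU.
have leI' : #|S :&: S'| <= #|P :&: P'|.
  apply: leq_trans leI _; apply/subset_leq_card/bigcupsP => x /setIP[xS xS'].
  rewrite subsetI; apply/andP; split; rewrite subsetU //; apply/orP; right.
    exact: (bigcup_sup x).
  exact: (bigcup_sup x).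
have leU' : #|S :|: S'| < #|P :|: P'|.
  apply: leq_trans leU _; apply/subset_leq_card/bigcupsP => x.
  rewrite !inE => /orP[/eqP ->|].
    apply/subsetP => t ta; rewrite !inE ta !andbT.
    by case: (t =P y) => //= ->; rewrite yy' orbT.
  by case/orP => xS; apply/subsetP => t tx; rewrite !inE;
    [have -> : t \in \bigcup_(x in S) N x by apply/bigcupP; exists x
    |have -> : t \in \bigcup_(x in S') N x by apply/bigcupP; exists x];
    rewrite ?orbT.
have := cardsUI P P'; have := cardsUI S S'; lia.
Qed.

(* Rado's proof: shrink the sets N x to singletons. *)
Lemma hall_marriage N D (u0 : U) : hall N D ->
  exists2 f : T -> U, {in D, forall x, f x \in N x} & {in D &, injective f}.
Proof.
have [k] := ubnP (\sum_(x in D) #|N x|); elim: k => // k IH in N * => leN hN.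
case: (boolP [exists a in D, 1 < #|N a|]) => [/existsP[a /andP[aD]] | small].
  case/card_gt1P=> y [y' [ya y'a yy']].
  have shrink t : t \in N a -> hall [eta N with a |-> N a :\ t] D ->
      exists2 f : T -> U, {in D, forall x, f x \in N x} & {in D &, injective f}.
    move=> ta; case/IH=> [|f fN fI].
      rewrite -ltnS; apply: leq_trans leN; rewrite ltnS.
      rewrite (big_setD1 a) //= [X in _ < X](big_setD1 a) //=.
      rewrite eqxx [#|N a|](cardsD1 t) ta add1n addSn ltnS leq_add2l.
      by apply: leq_sum => x; rewrite !inE => /andP[/negPf -> _].
    exists f => // x /fN /=; case: (x =P a) => // ->; by rewrite inE => /andP[].
  by case/orP: (hall_erase aD ya y'a yy' hN) => /shrink; apply.
have N1 a : a \in D -> exists y, N a = [set y].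
  move=> aD; apply/cards1P; move: small; rewrite negb_exists => /forallP/(_ a).
  rewrite aD -leqNgt eqn_leq => ->.
  have /forallP/(_ [set a]) := hN.
  by rewrite sub1set aD cards1 big_set1.
exists (fun x => odflt u0 [pick y in N x]) => [x xD|x y xD yD].
  by case: pickP => [//|n0]; have [t et] := N1 _ xD; have := n0 t; rewrite et set11.
have [t et] := N1 _ xD; have [t' et'] := N1 _ yD.
rewrite et et'.
have p1 (s : U) : odflt u0 [pick y in [set s]] = s.
  by case: pickP => [v /set1P|/(_ s)] //; rewrite set11.
rewrite !p1 => ?; subst t'; apply/eqP; apply/negPn/negP => xy.
have /forallP/(_ [set x; y]) := hN.
rewrite subUset !sub1set xD yD /= cards2 xy.
rewrite (_ : \bigcup_(_ in _) _ = [set t]) ?cards1 //.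
apply/eqP; rewrite eqEsubset; apply/andP; split.
  by apply/bigcupsP => v; rewrite !inE => /orP[]/eqP->; rewrite ?et ?et'.
by rewrite -et; apply: (bigcup_sup x); rewrite ?set21.
Qed.

End Hall.

(** * Neighbourhoods in matching covered graphs and in braces *)

Section Neighborhoods.
Variables (G : sgraph) (A : {set G}).
Hypotheses (conG : connected G) (ecG : edge_covered G) (cA : coloring A).
Implicit Types (S X : {set G}) (m : G -> G).

Definition nbr S : {set G} := \bigcup_(x in S) [set y | adj x y].

Lemma nbrP S y : reflect (exists2 x, x \in S & adj x y) (y \in nbr S).
Proof.
by apply: (iffP bigcupP) => -[x xS]; rewrite ?inE => axy; exists x; rewrite ?inE.
Qed.

Lemma nbr_color S y : S \subset A -> y \in nbr S -> y \notin A.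
Proof.
by move=> /subsetP SA /nbrP[x /SA xA axy]; rewrite (cA axy) xA.
Qed.

Lemma matching_nbr m S : matching m -> m @: S \subset nbr S.
Proof.
move=> [adjm _]; apply/subsetP => _ /imsetP[x xS ->].
by apply/nbrP; exists x.
Qed.

(** By cardinality [f] maps [A] onto its complement, and the inverse [g] completes it to an
    involution. *)
Lemma matching_of_injection (f : G -> G) : #|~: A| <= #|A| ->
  {in A, forall x, adj x (f x)} -> {in A &, injective f} ->
  exists2 m, matching m & {in A, m =1 f}.
Proof.
move=> cardA adjf fI.
have fA x : x \in A -> f x \notin A by move=> xA; rewrite (cA (adjf x xA)) xA.
have imf : f @: A = ~: A.
  apply/eqP; rewrite eqEcard (card_in_imset fI) cardA andbT.
  by apply/subsetP => _ /imsetP[x xA ->]; rewrite inE fA.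
have gP y : y \notin A -> exists2 x, x \in A & f x = y.
  by rewrite -in_setC -imf => /imsetP[x xA ->]; exists x.
pose g y := odflt y [pick x in A | f x == y].
have gA y : y \notin A -> g y \in A /\ f (g y) = y.
  move=> yA; rewrite /g; case: pickP => [x /andP[xA /eqP]//|n0].
  by have [x xA e] := gP _ yA; have := n0 x; rewrite xA e eqxx.
exists (fun x => if x \in A then f x else g x); last by move=> x /= ->.
split=> x; case: (boolP (x \in A)) => xA; first exact: adjf.
- by have [gxA fg] := gA x xA; rewrite -{1}fg adj_sym adjf.
- rewrite (negPf (fA _ xA)); have [gxA fg] := gA _ (fA _ xA).
  exact: fI.
- by have [-> ->] := gA x xA.
Qed.

Variables (m0 : G -> G) (mm0 : matching m0).

(** Otherwise every matching maps [S] onto [nbr S]. As every edge lies in a matching, no edge leaves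
    [S :|: nbr S], and connectedness puts all of [A] into [S]. *)
Lemma card_nbr S : S \subset A -> S != set0 -> S != A -> #|S| < #|nbr S|.
Proof.
move=> SA S0 SnA.
have inj m : matching m -> injective m by case=> _; apply: inv_inj.
rewrite ltnNge; apply/negP => le.
have eqN m : matching m -> m @: S = nbr S.
  move=> mm; apply/eqP; rewrite eqEcard matching_nbr //.
  by rewrite card_imset //; apply: inj.
have cl : closed (@adj G) (S :|: nbr S).
  apply: intro_closed; first exact/sym_connect_sym/adj_sym.
  move=> x y axy; rewrite !inE => /orP[xS | xN].
    by apply/orP; right; apply/nbrP; exists x.
  have [m mm mxy] := ecG axy; have mK := proj2 mm.
  move: xN; rewrite -(eqN _ mm) => /imsetP[s sS e].
  by rewrite -mxy e mK sS.
case/negP: SnA; rewrite eqEsubset SA /=; apply/subsetP => a aA.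
have [s sS] := set0Pn _ S0.
have := closed_connect cl (proj2 conG s a); rewrite !inE sS /= => /esym.
by case/orP=> // /(nbr_color SA); rewrite aA.
Qed.

Hypothesis noG : forall Z : {set G}, nontrivial Z -> ~ tight Z.

(** With a surplus of only one, every matching leaves [S :|: nbr S] through the one vertex of
    [nbr S] not matched into [S]. This tight cut is nontrivial, as two vertices of [A] lie
    outside. *)
Lemma brace_nbr S : S \subset A -> S != set0 -> #|S| + 2 <= #|A| ->
  #|S| + 2 <= #|nbr S|.
Proof.
move=> SA S0 SA2.
have SnA : S != A by apply/eqP => e; move: SA2; rewrite e; lia.
have lt := card_nbr SA S0 SnA.
rewrite addn2 ltn_neqAle lt andbT; apply/eqP => eN.
have S1 : 0 < #|S| by rewrite card_gt0.
have dis : [disjoint S & nbr S].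
  rewrite disjoint_subset; apply/subsetP => x xS; rewrite inE.
  by apply/negP => /(nbr_color SA); rewrite (subsetP SA).
apply: (@noG (S :|: nbr S)).
  split; first by rewrite cardsU disjoint_setI0 // cards0; lia.
  apply: (@leq_trans #|A :\: S|).
    by rewrite cardsD (setIidPr SA); lia.
  apply: subset_leq_card; apply/subsetP => x /setDP[xA xS].
  rewrite !inE (negPf xS) /=; apply/negP => /(nbr_color SA).
  by rewrite xA.
apply/tightP => m mm; have [adjm mK] := mm.
have sub := matching_nbr S mm.
have -> : crossing m (S :|: nbr S) = nbr S :\: m @: S.
  apply/setP => x; rewrite in_set !in_setU in_setD negb_or.
  have mS : (x \in m @: S) = (m x \in S).
    apply/imsetP/idP => [[s sS ->]|]; first by rewrite mK.
    by exists (m x); rewrite ?mK.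
  rewrite mS; case: (boolP (x \in S)) => xS /=.
    have -> : m x \in nbr S by apply/nbrP; exists x.
    rewrite andbF; apply/esym/negP => /andP[_] /(nbr_color SA).
    by rewrite (subsetP SA).
  case: (boolP (x \in nbr S)) => xN; rewrite ?andbF ?andbT //=.
  case: (boolP (m x \in nbr S)) => mxN; rewrite ?andbT //.
  have := nbr_color SA mxN; rewrite (cA (adjm x)) negbK.
  by rewrite (negPf (nbr_color SA xN)).
rewrite cardsD (setIidPr sub) card_imset; last exact: inv_inj.
lia.
Qed.

(** Deleting the ends of both edges costs a subset of [A] at most two neighbours, which the surplus
    from [brace_nbr] compensates; Hall's theorem matches the rest. *)
Lemma brace_extend x1 y1 x2 y2 : x1 \in A -> x2 \in A -> x1 != x2 -> y1 != y2 ->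
  adj x1 y1 -> adj x2 y2 -> exists2 m, matching m & m x1 = y1 /\ m x2 = y2.
Proof.
move=> x1A x2A x12 y12 a1 a2.
pose N x := [set y | adj x y] :\: [set y1; y2].
have hN : hall N (A :\: [set x1; x2]).
  apply/forallP => S; apply/implyP => SD.
  case: (eqVneq S set0) => [->|S0]; first by rewrite cards0.
  have SA : S \subset A by apply: subset_trans SD (subsetDl _ _).
  have -> : \bigcup_(x in S) N x = nbr S :\: [set y1; y2].
    apply/setP => y; rewrite in_setD; apply/bigcupP/andP.
      by case=> x xS /setDP[]; rewrite inE => axy ->; split=> //; apply/nbrP; exists x.
    by case=> yn /nbrP[x xS axy]; exists x; rewrite // in_setD yn inE.
  have : #|S| + 2 <= #|nbr S|.
    apply: brace_nbr => //.
    have := subset_leq_card SD; rewrite cardsD (setIidPr _) ?cards2 ?x12; last first.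
      by rewrite subUset !sub1set x1A.
    have : #|[set x1; x2]| <= #|A| by rewrite subset_leq_card // subUset !sub1set x1A.
    by rewrite cards2 x12; lia.
  have := cardsID [set y1; y2] (nbr S).
  have := subset_leq_card (subsetIr (nbr S) [set y1; y2]).
  by rewrite cards2 y12; lia.
have [f fN fI] := hall_marriage y1 hN.
pose f' x := if x == x1 then y1 else if x == x2 then y2 else f x.
have fP x : x \in A -> x != x1 -> x != x2 -> [/\ adj x (f x), f x != y1 & f x != y2].
  move=> xA n1 n2; have := fN x; rewrite !inE (negPf n1) (negPf n2) xA => /(_ isT).
  by rewrite negb_or => /andP[/andP[-> ->] ->].
have [|||m mm mf] := @matching_of_injection f'.
- by rewrite (card_coloring mm0 cA).
- move=> x xA; rewrite /f'; case: eqP => [->//|/eqP n1]; case: eqP => [->//|/eqP n2].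
  by case: (fP x xA n1 n2).
- have fD x : x \in A -> x != x1 -> x != x2 -> x \in A :\: [set x1; x2].
    by move=> xA n1 n2; rewrite !inE (negPf n1) (negPf n2).
  move=> x x' xA x'A; rewrite /f'.
  case: (eqVneq x x1) => [->|n1]; case: (eqVneq x' x1) => [->|n1'] //.
  + case: (eqVneq x' x2) => [_ /eqP|n2' /esym/eqP]; first by rewrite (negPf y12).
    by have [_ /negPf -> _] := fP _ x'A n1' n2'.
  + case: (eqVneq x x2) => [_ /esym/eqP|n2 /eqP]; first by rewrite (negPf y12).
    by have [_ /negPf -> _] := fP _ xA n1 n2.
  case: (eqVneq x x2) => [->|n2]; case: (eqVneq x' x2) => [->|n2'] //.
  + by move=> /esym/eqP; have [_ _ /negPf ->] := fP _ x'A n1' n2'.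
  + by move=> /eqP; have [_ _ /negPf ->] := fP _ xA n1 n2.
  by apply: fI; apply: fD.
exists m => //; rewrite !mf // /f' !eqxx; split=> //.
by rewrite eq_sym (negPf x12).
Qed.

(** A stable [X] has as many vertices outside [A] as in [P], so at most [#|P|] neighbours of a
    subset of [P] lie in [X]; the others, forced by [brace_nbr], lie outside. *)
Lemma brace_crossing_edges X : stable m0 X -> 2 <= #|A :&: X| -> 2 <= #|A :\: X| ->
  exists x1 y1 x2 y2, [/\ x1 \in A :&: X, x2 \in A :&: X, x1 != x2, y1 != y2 &
    [/\ adj x1 y1, adj x2 y2, y1 \notin X & y2 \notin X]].
Proof.
move=> sX P2 Q2; pose P := A :&: X.
have cX : #|X :\: A| = #|P| by rewrite /P setIC (card_stable mm0 cA sX).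
have cP : #|P| + #|A :\: X| = #|A| by rewrite cardsID.
have out S k : S \subset P -> S != set0 -> #|P| + k <= #|S| + 2 ->
    k <= #|nbr S :\: X|.
  move=> SP S0 le.
  have SA : S \subset A by apply: subset_trans SP (subsetIl _ _).
  have : #|S| + 2 <= #|nbr S|.
    by apply: brace_nbr => //; have := subset_leq_card SP; lia.
  have : #|nbr S :&: X| <= #|X :\: A|.
    apply: subset_leq_card; apply/subsetP => y /setIP[yN yX].
    by rewrite inE yX (nbr_color SA yN).
  have := cardsID X (nbr S); lia.
have P0 : P != set0 by rewrite -card_gt0 (leq_trans _ P2).
have /card_gt1P[y1 [y2 [+ + y12]]] : 1 < #|nbr P :\: X|.
  by apply: out => //; lia.
case/setDP=> /nbrP[x1 x1P a1] y1X; case/setDP=> /nbrP[x2 x2P a2] y2X.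
case: (eqVneq x1 x2) => [e|x12]; last by exists x1, y1, x2, y2; split.
(* Both neighbours hang on [x1]. The set [P :\ x1] still has a neighbour [y3] outside [X], and [y3]
   differs from [y1] or from [y2]. *)
subst x2.
have cP1 : #|P| = #|P :\ x1|.+1 by rewrite (cardsD1 x1) x1P.
have /card_gt0P[y3 /setDP[/nbrP[x3 /setD1P[x31 x3P] a3] y3X]] :
    0 < #|nbr (P :\ x1) :\: X|.
  apply: out; rewrite ?subD1set // -?card_gt0; first by rewrite /P in cP1 *; lia.
  lia.
case: (eqVneq y3 y1) => [e|n31].
  by exists x3, y3, x1, y2; split=> //; rewrite e.
by exists x3, y3, x1, y1; split.
Qed.

End Neighborhoods.

(** * Recognition of the braces C4 and K33 *)

Definition complete_coloring (G : sgraph) (A : {set G}) :=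
  forall x y : G, adj x y = ((x \in A) != (y \in A)).

Lemma enum_injection (T U : finType) (S : {set T}) (R : {set U}) (u : U) :
  #|S| = #|R| -> exists2 f : T -> U, {in S, forall x, f x \in R} & {in S &, injective f}.
Proof.
move=> e; have idx x : x \in S -> index x (enum S) < size (enum R).
  by move=> xS; rewrite -cardE -e cardE index_mem mem_enum.
exists (fun x => nth u (enum R) (index x (enum S))) => [x xS|x y xS yS /eqP].
  by rewrite -mem_enum mem_nth ?idx.
rewrite nth_uniq ?idx ?enum_uniq // => /eqP; apply: (index_inj x).
all: by rewrite mem_enum.
Qed.

Lemma complete_isomorphic (G H : sgraph) (A : {set G}) (C : {set H}) (h : H) :
  complete_coloring A -> complete_coloring C ->
  #|A| = #|C| -> #|~: A| = #|~: C| -> isomorphic G H.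
Proof.
move=> kA kC cAC cAC'.
have [f fC fI] := enum_injection h cAC; have [g gC gI] := enum_injection h cAC'.
pose F x := if x \in A then f x else g x.
have FC x : (F x \in C) = (x \in A).
  rewrite /F; case: (boolP (x \in A)) => xA; first by rewrite fC.
  by apply/negbTE; have := gC x; rewrite !inE; apply.
exists F => [|x y]; last by rewrite kA kC !FC.
apply: inj_card_bij; last by rewrite -(cardsC A) cAC cAC' cardsC.
move=> x y e; have := FC x; rewrite e FC => eA; move: e; rewrite /F eA.
case: (boolP (x \in A)) => xA; first by apply: fI; rewrite ?eA.
by apply: gI; rewrite inE ?eA.
Qed.

Lemma isomorphic_C4 (G : sgraph) (A : {set G}) :
  complete_coloring A -> #|A| = 2 -> #|~: A| = 2 -> isomorphic G C4.
Proof.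
move=> kA cA cA'; pose C : {set C4} := [set i : 'I_4 | odd i].
have cC : #|C| = 2 by rewrite -sum1_card big_mkcond !big_ord_recl big_ord0 !inE.
apply: (@complete_isomorphic _ C4 A C ord0) => //; rewrite ?cA ?cA' ?cC //.
  by case=> [[|[|[|[|i]]]] ?] // [[|[|[|[|j]]]] ?] //; rewrite !inE.
by have := cardsC C; rewrite cC card_ord; lia.
Qed.

Lemma isomorphic_K33 (G : sgraph) (A : {set G}) :
  complete_coloring A -> #|A| = 3 -> #|~: A| = 3 -> isomorphic G K33.
Proof.
move=> kA cA cA'; pose C : {set K33} := setX [set true] setT.
have cC : #|C| = 3 by rewrite cardsX cards1 cardsT card_ord.
apply: (@complete_isomorphic _ K33 A C (true, ord0)) => //; rewrite ?cA ?cA' ?cC //.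
  by case=> [[] i] [[] j]; rewrite !inE.
by have := cardsC C; rewrite cC card_prod card_bool card_ord; lia.
Qed.

Lemma connected_matching (G : sgraph) : 1 < #|G| -> connected G ->
  edge_covered G -> exists m : G -> G, matching m.
Proof.
move=> /card_gt1P[x [y [_ _ xy]]] [_ con] ec.
have /connectP[[|z p] /= ] := con x y; first by move=> _ e; rewrite e eqxx in xy.
by case/andP=> /ec[m mm _] _ _; exists m.
Qed.

Lemma splittable_brace (G : sgraph) (A : {set G}) :
  2 < #|G| -> connected G -> edge_covered G -> coloring A ->
  (forall Z : {set G}, nontrivial Z -> ~ tight Z) -> splittable G ->
  isomorphic G C4 \/ isomorphic G K33.
Proof.
move=> G3 con ec cA noG [m mm spl].
have cAC := card_coloring mm cA.
have cG := cardsC A; have A2 : 2 <= #|A| by lia.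
(* A larger [A] would be split by some [X]; two disjoint edges leaving [X] from [A] extend to one
   matching, which crosses [X] at least four times. *)
have A3 : #|A| <= 3.
  rewrite leqNgt; apply/negP => /spl[X [sX tX AX AXC]].
  have [x1 [y1 [x2 [y2 [/setIP[x1A x1X] /setIP[x2A x2X] x12 y12 [a1 a2 y1X y2X]]]]]] :=
    brace_crossing_edges con ec cA mm noG sX AX AXC.
  have [m' mm' [m1 m2]] := brace_extend con ec cA mm noG x1A x2A x12 y12 a1 a2.
  have := tX _ mm'; rewrite (card_crossing_half mm sX mm' cA).
  suff : 1 < #|crossing m' X :&: A| by lia.
  by apply/card_gt1P; exists x1, x2; rewrite !inE m1 m2 x1A x2A x1X x2X y1X y2X.
have kA : complete_coloring A.
  (* A single vertex has at least three neighbours if [A] has three elements, and at least two if it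
     has two: in both cases the whole other class. *)
  have xN x : x \in A -> nbr [set x] = ~: A.
    move=> xA; have xA1 : [set x] \subset A by rewrite sub1set.
    have x0 : [set x] != set0 by rewrite -card_gt0 cards1.
    apply/eqP; rewrite eqEcard cAC; apply/andP; split.
      by apply/subsetP => y /(nbr_color cA xA1); rewrite inE.
    case: (ltnP 2 #|A|) => [lt|le].
      have := brace_nbr con ec cA noG xA1 x0; rewrite cards1; lia.
    have := card_nbr con ec cA xA1 x0.
    rewrite cards1; have -> : [set x] != A; last by move/(_ isT); lia.
    by apply/eqP => e; rewrite -e cards1 in A2.
  have kA' x y : x \in A -> y \notin A -> adj x y.
    move=> xA yA; have : y \in nbr [set x] by rewrite xN ?inE.
    by case/nbrP=> z /set1P ->.
  move=> x y; apply/idP/idP => [/cA ->|]; first by case: (x \in A).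
  case: (boolP (x \in A)) => xA; case: (boolP (y \in A)) => yA // _.
    exact: kA'.
  by rewrite adj_sym kA'.
case: (ltnP 2 #|A|) => [lt|le].
  by right; apply: (isomorphic_K33 kA); lia.
by left; apply: (isomorphic_C4 kA); lia.
Qed.

(** * Shores of cubic trees *)

Section Shores.
Variables (G : sgraph) (D : pm_decomposition G).
Local Notation T := (tree D).
Implicit Types (t u v y : T).

Lemma connect_restrict (V : finType) (e e' : rel V) (a b : V) :
  (forall c d, connect e a c -> connect e a d -> e c d -> e' c d) ->
  connect e a b -> connect e' a b.
Proof.
move=> ee' /connectP[p + ->]; elim/last_ind: p => [|p c IH]; first by rewrite connect0.
rewrite rcons_path last_rcons => /andP[pp ec].
have cl : connect e a (last a p) by apply/connectP; exists p.
apply: connect_trans (IH pp) (connect1 (ee' _ _ cl _ ec)).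
exact: connect_trans cl (connect1 ec).
Qed.

Lemma tree_minusC t1 t2 : tree_minus t1 t2 =2 tree_minus t2 t1.
Proof. by move=> x y; rewrite /tree_minus [[set t1; _]]setUC. Qed.

Lemma connect_minusC t1 t2 : connect (tree_minus t1 t2) =2 connect (tree_minus t2 t1).
Proof. exact/eq_connect/tree_minusC. Qed.

Lemma tree_minus_sym t1 t2 : connect_sym (tree_minus t1 t2).
Proof.
by apply: sym_connect_sym => x y; rewrite /tree_minus adj_sym [[set x; _]]setUC.
Qed.

(** A path from [t1] to [t2] avoiding the edge would close up with it to a cycle of length at least
    three. *)
Lemma tree_bridge t1 t2 : adj t1 t2 -> ~~ connect (tree_minus t1 t2) t1 t2.
Proof.
move=> a12; apply/negP => /connectP[p pp ep].
case/shortenP: pp ep => q pq uq _ eq.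
have [_ acy _] := tree_cubic D.
have /acy : ucycle (@adj T) (t1 :: q).
  rewrite /ucycle uq andbT /cycle rcons_path -eq adj_sym a12 andbT.
  by apply: sub_path pq => x y /andP[].
case: q pq uq eq => [|x [|y q]] //= pq _ e.
  by rewrite e adj_irrefl in a12.
by move: pq; rewrite e andbT /tree_minus eqxx andbF.
Qed.

Lemma tree_sides t1 t2 y : adj t1 t2 ->
  connect (tree_minus t2 t1) t2 y = ~~ connect (tree_minus t1 t2) t1 y.
Proof.
move=> a12; rewrite connect_minusC; apply/idP/idP => [c2|].
  apply: contra (tree_bridge a12) => c1; apply: connect_trans c1 _.
  by rewrite tree_minus_sym.
have [[_ con] _ _] := tree_cubic D.
have /connectP[p + ->] := con t1 y.
elim/last_ind: p => [|p z IH]; first by rewrite connect0.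
rewrite rcons_path last_rcons => /andP[pp az] n1.
set w := last t1 p in IH az.
case: (boolP ([set w; z] == [set t1; t2])) => [/eqP/set2_eq[[_ ->]|[_ ez]]|nwz].
- exact: connect0.
- by rewrite ez connect0 in n1.
have wz : connect (tree_minus t1 t2) w z by rewrite connect1 // /tree_minus az.
apply: (connect_trans _ wz); apply: IH => //.
by apply: contra n1 => c1; exact: connect_trans c1 wz.
Qed.

(** A path without repetition never returns to [t1], so after its first step to [u] it avoids the
    edge between [u] and [t1]. *)
Lemma tree_branch t1 t2 y : adj t1 t2 -> connect (tree_minus t1 t2) t1 y ->
  y = t1 \/ exists u, [/\ adj t1 u, u != t2 & connect (tree_minus u t1) u y].
Proof.
move=> a12 /connectP[p pp ->]; case/shortenP: pp => -[|u q] /=; first by left.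
case/andP=> /andP[a1u n12] pq /andP[n1q uq] _; right; exists u; split=> //.
  by apply: contraNneq n12 => ->.
apply/connectP; exists q => //.
apply: (@sub_in_path _ (predC1 t1) (tree_minus t1 t2)) pq => [x z nx nz /andP[axz _]|].
  rewrite /tree_minus axz; apply/eqP => /set2_eq[] [e1 e2].
    by rewrite !inE e2 eqxx in nz.
  by rewrite !inE e1 eqxx in nx.
by apply/allP => x xq; rewrite inE; apply: contraNneq n1q => <-.
Qed.

Definition side t1 t2 := [set y | connect (tree_minus t1 t2) t1 y].

Lemma side_proper t1 t2 u : adj t1 t2 -> adj t1 u -> u != t2 ->
  #|side u t1| < #|side t1 t2|.
Proof.
move=> a12 a1u ut2; have au1 : adj u t1 by rewrite adj_sym.
have n1 : t1 \notin side u t1 by rewrite inE tree_bridge.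
apply: proper_card; apply/properP; split; last by exists t1; rewrite // inE connect0.
apply/subsetP => y; rewrite !inE => cy.
have e1u : tree_minus t1 t2 t1 u.
  rewrite /tree_minus a1u; apply/eqP => /set2_eq[[_ e]|[e _]].
    by rewrite e eqxx in ut2.
  by rewrite e adj_irrefl in a12.
apply: connect_trans (connect1 e1u) (connect_restrict _ cy) => c d cc cd /andP[acd _].
rewrite /tree_minus acd; apply/eqP => /set2_eq[] [e1 e2].
  by rewrite e1 in cc; rewrite inE cc in n1.
by rewrite e2 in cd; rewrite inE cd in n1.
Qed.

Lemma mem_shore t1 t2 l : (@delta G D l \in shore t1 t2) = (val l \in side t1 t2).
Proof.
rewrite inE; apply/imsetP/idP => [[l']|cl].
  by rewrite inE => cl' /(bij_inj (@delta_bij _ D)) ->.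
by exists l; rewrite ?inE.
Qed.

Lemma delta_surj (x : G) : exists l, x = @delta G D l.
Proof. by have [g _ gK] := @delta_bij _ D; exists (g x); rewrite gK. Qed.

Lemma shoreC t1 t2 : adj t1 t2 -> shore t2 t1 = ~: shore t1 t2.
Proof.
move=> a12; apply/setP => x; have [l ->] := delta_surj x.
by rewrite in_setC !mem_shore !inE tree_sides.
Qed.

Lemma leaf_shore t1 t2 : t1 \in leaf T -> adj t1 t2 -> #|shore t1 t2| <= 1.
Proof.
rewrite inE => /cards1P[v ev] a12.
have nv u : adj t1 u -> u = v by move=> a; apply/set1P; rewrite -ev inE.
apply/card_le1_eqP => x y; have [l ->] := delta_surj x; have [l' ->] := delta_surj y.
have st w : w \in side t1 t2 -> w = t1.
  rewrite inE => /(tree_branch a12)[//|[u [a1u]]].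
  by rewrite (nv _ a1u) (nv _ a12) eqxx.
by rewrite !mem_shore => /st e /st e'; congr delta; apply: val_inj; rewrite e e'.
Qed.

Lemma shore_branch t1 t2 : adj t1 t2 -> t1 \notin leaf T -> exists u v,
  [/\ adj t1 u, u != t2, adj t1 v, v != t2 &
      shore t1 t2 \subset shore u t1 :|: shore v t1].
Proof.
move=> a12 nl1; have [_ _ /(_ _ nl1) deg] := tree_cubic D.
have /eqP := deg; rewrite /degree (cardsD1 t2) inE a12 add1n eqSS.
case/cards2P=> u [v [uv euv]].
have uvP w : (w \in [set u; v]) = (w != t2) && adj t1 w by rewrite -euv !inE.
have /andP[ut2 a1u] : (u != t2) && adj t1 u by rewrite -uvP set21.
have /andP[vt2 a1v] : (v != t2) && adj t1 v by rewrite -uvP set22.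
exists u, v; split=> //; apply/subsetP => x; have [l ->] := delta_surj x.
rewrite in_setU !mem_shore !inE => /(tree_branch a12)[e|[w [a1w wt2 cw]]].
  by case/negP: nl1; rewrite -e; exact: valP.
have : w \in [set u; v] by rewrite uvP wt2.
by rewrite !inE => /orP[] /eqP <-; rewrite cw ?orbT.
Qed.

(** Among oriented edges whose shore contains two elements of [W], take one with the smallest side.
    Each further branch at [t1] holds at most one element of [W], so the shore holds exactly two and
    at least two remain outside. *)
Lemma balanced_shore (W : {set G}) : 4 <= #|W| -> exists t1 t2,
  [/\ adj t1 t2, t1 \notin leaf T, t2 \notin leaf T,
      2 <= #|W :&: shore t1 t2| & 2 <= #|W :\: shore t1 t2|].
Proof.
move=> W4.
pose heavy (t : T * T) := adj t.1 t.2 && (2 <= #|W :&: shore t.1 t.2|).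
have [t0 ht0] : exists t : T * T, heavy t.
  have [x xW] : exists x, x \in W by apply/card_gt0P; rewrite (leq_trans _ W4).
  have [t lt] : exists t, t \in leaf T by have [[t lt] _] := delta_surj x; exists t.
  have [v atv] : exists v, adj t v.
    by move: lt; rewrite inE => /cards1P[v /setP/(_ v)]; rewrite !inE eqxx; exists v.
  (* One of the two orientations of an edge at a leaf is heavy, as [W] has at least four
     elements. *)
  case: (ltnP 1 #|W :&: shore t v|) => h; first by exists (t, v); rewrite /heavy atv.
  exists (v, t); rewrite /heavy /= adj_sym atv shoreC //= -setDE.
  by have := cardsID (shore t v) W; lia.
case: (arg_minnP (fun t : T * T => #|side t.1 t.2|) ht0) => -[t1 t2].
move=> /andP[/= a12 h12] min.
have nl1 : t1 \notin leaf T.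
  apply/negP => l1; have := leaf_shore l1 a12.
  by have := subset_leq_card (subsetIr W (shore t1 t2)); lia.
have [u [v [a1u ut2 a1v vt2 sub]]] := shore_branch a12 nl1.
have light w : adj t1 w -> w != t2 -> #|W :&: shore w t1| <= 1.
  move=> a1w wt2; rewrite leqNgt; apply/negP => hw.
  have := min (w, t1); rewrite /heavy /= adj_sym a1w hw => /(_ isT).
  by rewrite leqNgt side_proper.
have le2 : #|W :&: shore t1 t2| <= 2.
  apply: (@leq_trans #|(W :&: shore u t1) :|: (W :&: shore v t1)|).
    by rewrite -setIUr; apply/subset_leq_card/setIS.
  rewrite cardsU; have := light _ a1u ut2; have := light _ a1v vt2; lia.
have h21 : 2 <= #|W :\: shore t1 t2| by have := cardsID (shore t1 t2) W; lia.
exists t1, t2; split=> //; apply/negP => l2.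
have a21 : adj t2 t1 by rewrite adj_sym.
have := leaf_shore l2 a21; rewrite shoreC //.
by have := subset_leq_card (subsetIr W (~: shore t1 t2)); rewrite -setDE; lia.
Qed.

End Shores.

(** * Width two as a splitting property, and the lower bound on the width *)

Lemma decomposition_splittable (G : sgraph) (D : pm_decomposition G) (m : G -> G) :
  matching m -> M_decomposition D (matching_edges m) -> width D <= 2 ->
  splittable G.
Proof.
move=> mm MD wD; exists m => // W W4.
have [t1 [t2 [a12 nl1 nl2 h h']]] := balanced_shore D W4.
exists (shore t1 t2); split=> //.
  by apply/(conformalP _ mm); case: (MD _ _ a12 nl1 nl2).
move=> m' mm'; have := leq_trans (leq_bigmax_cond (t1, t2) a12) wD.
by move/porosity_leqP; apply.
Qed.

(** A balanced shore is stable and hence crossed an even number of times; with porosity at most one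
    it is never crossed. As every edge lies in a matching, the shore is closed under adjacency,
    against connectedness. *)
Lemma width_ge2 (G : sgraph) (D : pm_decomposition G) (A : {set G}) (m : G -> G) :
  3 < #|G| -> connected G -> edge_covered G -> coloring A ->
  matching m -> M_decomposition D (matching_edges m) -> 2 <= width D.
Proof.
move=> G4 [_ con] ec cA mm MD.
have [|t1 [t2 [a12 nl1 nl2 h h']]] := @balanced_shore _ D setT.
  by rewrite cardsT.
set X := shore t1 t2 in h h'; rewrite setTI in h; rewrite setTD in h'.
have sX : stable m X by apply/(conformalP _ mm); case: (MD _ _ a12 nl1 nl2).
apply: leq_trans (leq_bigmax_cond (t1, t2) a12).
rewrite leqNgt; apply/negP => /porosity_leqP thX.
have [x xX] : exists x, x \in X by apply/card_gt0P/ltnW.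
have [y yX] : exists x, x \in ~: X by apply/card_gt0P/ltnW.
have cl : closed (@adj G) X.
  apply: intro_closed; first exact/sym_connect_sym/adj_sym.
  move=> a b aab aX; apply/negPn/negP => bX.
  have [m' mm' mab] := ec _ _ aab.
  have := thX _ mm'; rewrite (card_crossing_half mm sX mm' cA).
  have : 0 < #|crossing m' X| by apply/card_gt0P; exists a; rewrite inE aX mab.
  rewrite (card_crossing_half mm sX mm' cA); lia.
by have := closed_connect cl (con x y); rewrite xX; rewrite inE in yX; rewrite (negPf yX).
Qed.

(** * Assembling a decomposition along tight cuts *)

(** A derivation is a binary tree with edges of [m] at its leaves. Thinness is asked only of unions,
    since a pair is thin by its size. *)
Inductive assembled (G : sgraph) (m : G -> G) : {set G} -> Prop :=
| assembled_pair x : assembled m [set x; m x]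
| assembled_union (X Y : {set G}) : assembled m X -> assembled m Y ->
    [disjoint X & Y] -> thin (X :|: Y) -> assembled m (X :|: Y).

Lemma thin_coPair (G : sgraph) (x y : G) : thin (~: [set x; y]).
Proof. by apply/thinC/thin_small; rewrite cards2; case: eqP. Qed.

Section AssembleContraction.
Variables (G : sgraph) (Z : {set G}) (m : G -> G) (z : G).
Hypotheses (tZ : tight Z) (mm : matching m) (crossz : crossing m Z = [set z]).
Local Notation m1 := (@proj_matching G Z z m).
Local Notation preim X := (@proj G Z @^-1: X).

Lemma thin_preim (X : {set contraction Z}) : thin X -> thin (preim X).
Proof.
move=> tX m' mm'.
have /eqP/cards1P[z' crossz'] := proj1 (tightP Z) tZ _ mm'.
apply: leq_trans (tX _ (proj_matchingP mm' crossz')).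
apply: crossing_proj; first by rewrite crossz' cards1.
exact: proj_matching_compatible.
Qed.

Lemma preim_pair_out x : x \notin Z -> m x \notin Z ->
  preim [set proj Z x; m1 (proj Z x)] = [set x; m x].
Proof.
move=> xZ mxZ; rewrite (proj_matching_compatible crossz) ?(negPf xZ) //.
have pe a y : a \notin Z -> (proj Z y == proj Z a) = (y == a).
  move=> aZ; apply/eqP/eqP => [/proj_eq[//|[_]]|->//].
  by rewrite (negPf aZ).
by apply/setP => y; rewrite !inE !pe.
Qed.

Lemma preim_pair_in : preim [set None; m1 None] = Z :|: [set m z].
Proof.
apply/setP => y; rewrite !inE proj_eqNone; congr (_ || _).
have mzZ := crossz_out crossz.
apply/eqP/eqP => [/proj_eq[//|[_]]|->//]; by rewrite (negPf mzZ).
Qed.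

(** Matching edges that avoid the contracted vertex pull back to edges of [m]. The one at that
    vertex pulls back to [Z :|: [set m z]], the union of [[set z; m z]] and [Z :\ z]; there the
    assembly of [Z :\ z] is grafted. *)
Lemma assembled_preim (X : {set contraction Z}) :
  assembled m1 X -> (None \in X -> assembled m (Z :\ z)) ->
  assembled m (preim X).
Proof.
have [adjm mK] := mm; have zZ := crossz_in crossz; have mzZ := crossz_out crossz.
elim=> {X} [u|X Y _ IHX _ IHY dXY tXY] asm; last first.
  rewrite preimsetU; apply: assembled_union.
  - by apply: IHX => nX; apply: asm; rewrite inE nX.
  - by apply: IHY => nY; apply: asm; rewrite inE nY orbT.
  - rewrite disjoint_subset; apply/subsetP => x; rewrite !inE.
    by move/(disjointFr dXY) ->.
  - by rewrite -preimsetU; apply: thin_preim.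
case: (boolP (None \in [set u; m1 u])) => [nu|].
  have -> : [set u; m1 u] = [set None; m1 None].
    move: nu; rewrite !inE => /orP[] /eqP ->; first by [].
    by rewrite (proj2 (proj_matchingP mm crossz)) setUC.
  have thZ : thin (Z :|: [set m z]).
    by rewrite -preim_pair_in; apply/thin_preim/thin_small; rewrite cards2; case: eqP.
  rewrite preim_pair_in.
  have eZ : Z :|: [set m z] = [set z; m z] :|: (Z :\ z).
    apply/setP => y; rewrite !inE; case: (y =P z) => [->|]; rewrite ?zZ //=.
    by rewrite orbC.
  rewrite eZ in thZ *.
  apply: assembled_union => //; first exact: assembled_pair.
    exact: asm.
  rewrite disjoint_subset; apply/subsetP => y; rewrite !inE.
  by case/orP=> /eqP->; rewrite ?eqxx // (negPf mzZ) andbF.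
rewrite -{1 2 3}(vrepK u zZ) !inE negb_or => /andP[].
set x := vrep z u; rewrite ![None == _]eq_sym proj_eqNone => xZ.
rewrite (proj_matching_compatible crossz) ?(negPf xZ) // proj_eqNone => mxZ.
have := preim_pair_out xZ mxZ; rewrite (proj_matching_compatible crossz) ?(negPf xZ) //.
by move->; apply: assembled_pair.
Qed.

End AssembleContraction.

(** The complement consists of one or two further edges of [m], and is thin because the removed pair
    is. *)
Lemma assembled_small (G : sgraph) (m : G -> G) (x : G) : 2 < #|G| <= 6 ->
  ~~ odd #|G| -> matching m -> assembled m (~: [set x; m x]).
Proof.
move=> /andP[G3 G6] evG mm.
have card_pair y : #|[set y; m y]| = 2.
  by rewrite cards2 eq_sym (matching_neq _ mm).
have sub_pair y (X : {set G}) : stable m X -> y \in X -> [set y; m y] \subset X.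
  by move=> sX yX; rewrite subUset !sub1set sX yX.
pose X := ~: [set x; m x].
have sX : stable m X by apply/stableC/stable_pair.
have cX : 2 + #|X| = #|G| by rewrite -(card_pair x) cardsC.
have [y yX] : exists y, y \in X by apply/card_gt0P; lia.
have syX := sub_pair _ _ sX yX.
have eX := cardsID [set y; m y] X; rewrite (setIidPr syX) card_pair in eX.
case: (set_0Vmem (X :\: [set y; m y])) => [/eqP|[w wX]].
  rewrite setD_eq0 => /(conj syX)/andP; rewrite -eqEsubset -/X => /eqP <-.
  exact: assembled_pair.
have sX' : stable m (X :\: [set y; m y]).
  by rewrite setDE -[X in stable _ X]setCK setCI; apply/stableC/stableU;
    apply/stableC => //; apply/stableC/stable_pair.
have swX := sub_pair _ _ sX' wX.
have eqX : X = [set y; m y] :|: [set w; m w].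
  have /eqP -> : [set w; m w] == X :\: [set y; m y].
    by rewrite eqEcard swX card_pair; lia.
  by rewrite -{1}(setID X [set y; m y]) (setIidPr syX).
rewrite -/X eqX; apply: assembled_union; try exact: assembled_pair.
  by rewrite disjoint_sym disjoint_subset; apply/subsetP => t /(subsetP swX);
    rewrite !inE => /andP[].
by rewrite -eqX; apply: thin_coPair.
Qed.

Lemma nontrivial_contraction (G : sgraph) (Z : {set G}) :
  nontrivial Z -> 2 < #|contraction Z| < #|G|.
Proof.
move=> [Z1 Z1']; rewrite card_contraction; have := cardsC Z; lia.
Qed.

Lemma assembled_of_braces (G : sgraph) (A : {set G}) :
  2 < #|G| -> connected G -> edge_covered G -> coloring A ->
  (forall H, brace_of G H -> isomorphic H C4 \/ isomorphic H K33) ->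
  forall (m : G -> G) x, matching m -> assembled m (~: [set x; m x]).
Proof.
have [k] := ubnP #|G|; elim: k => // k IH in G A * => Gk G3 con ec cA br m x mm.
have cAC := card_coloring mm cA; have cG := cardsC A.
have evG : ~~ odd #|G| by rewrite -cG cAC addnn odd_double.
pose tightb (Z : {set G}) := [forall M in perfect_matchings G, #|M :&: cut Z| == 1].
have tightbP Z : reflect (tight Z) (tightb Z).
  by apply: (iffP forall_inP) => h M /h /eqP.
case: (boolP [exists Z : {set G}, [&& 1 < #|Z|, 1 < #|~: Z| & tightb Z]]); last first.
  (* Without a nontrivial tight cut the graph is its own brace, so it has four or six vertices. *)
  move=> no; apply: assembled_small => //; rewrite G3 /=.
  have /br : brace_of G G.
    apply: brace_of_self; first last.
      move=> Z [Z1 Z2] /tightbP tZ; case/negP: no; apply/existsP; exists Z.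
      by rewrite Z1 Z2.
    exists A, (~: A); split; first by rewrite setUCr.
      by rewrite disjoints_subset setCK.
    by move=> a b /cA; rewrite inE => ->; rewrite negbK.
  by case=> -[f /bij_eq_card -> _]; rewrite ?card_prod ?card_bool ?card_ord.
case/existsP=> Z0 /and3P[Z01 Z01' /tightbP tZ0].
have [Z [nZ tZ xZ]] : exists Z : {set G}, [/\ nontrivial Z, tight Z & x \notin Z].
  case: (boolP (x \in Z0)) => xZ0; last by exists Z0.
  exists (~: Z0); split; [exact: nontrivialC|exact: tightC|by rewrite inE negbK].
have piece (Y : {set G}) : nontrivial Y -> tight Y ->
    (forall H, brace_of (contraction Y) H -> brace_of G H) ->
    forall z u, crossing m Y = [set z] ->
    assembled (@proj_matching G Y z m) (~: [set u; @proj_matching G Y z m u]).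
  move=> nY tY brY z u crossz; have /andP[Y3 Yk] := nontrivial_contraction nY.
  have Y0 : exists t, t \in Y by case: nY => Y1 _; apply/card_gt0P; lia.
  apply: (IH (contraction Y) (proj_color Y A)) => //.
  - by lia.
  - exact: contraction_connected.
  - exact: contraction_covered.
  - exact: contraction_coloring.
  - by move=> H /brY/br.
  - exact: proj_matchingP.
have /eqP/cards1P[z crossz] := proj1 (tightP Z) tZ _ mm.
have zZ := crossz_in crossz; have mzZ := crossz_out crossz; have [_ mK] := mm.
have crossz' : crossing m (~: Z) = [set m z].
  apply/setP => y; rewrite !inE negbK; apply/andP/eqP => [[yZ myZ]|->].
    by rewrite -(crossz_eq crossz myZ) ?mK.
  by rewrite mK.
(* In the contraction of [~: Z], the complement of the matching edge at [None] pulls back to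
   [Z :\ z]; since it avoids [None], nothing has to be grafted. *)
have asmZ : assembled m (Z :\ z).
  have := piece _ (nontrivialC nZ) (tightC tZ)
    (fun H => brace_of_contractC nZ tZ) _ None crossz'.
  move/(assembled_preim (tightC tZ) mm crossz'); rewrite !inE eqxx.
  move=> /(_ (fun h => match notF h with end)).
  rewrite preimsetC (preim_pair_in crossz') mK.
  by congr assembled; apply/setP => y; rewrite !inE negb_or negbK andbC.
have lift u : assembled m (@proj G Z @^-1: ~: [set u; @proj_matching G Z z m u]).
  apply: (assembled_preim tZ mm crossz) => //.
  by apply: piece => // H; apply: brace_of_contract.
case: (boolP (m x \in Z)) => mxZ; last first.
  have := lift (proj Z x).
  by rewrite preimsetC (preim_pair_out crossz).
have ez : z = m x by apply/esym/(crossz_eq crossz mxZ); rewrite mK.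
have := lift None; rewrite preimsetC (preim_pair_in crossz) => asmC.
have eX : ~: [set x; m x] = ~: (Z :|: [set m z]) :|: Z :\ z.
  apply/setP => y; rewrite !inE ez mK !negb_or.
  case: (boolP (y \in Z)) => yZ; rewrite ?andbT ?orbF //=.
    by case: eqP => // e; rewrite -e yZ in xZ.
  by case: (y =P m x) => [e|]; rewrite ?andbT // e mxZ in yZ.
rewrite eX; apply: assembled_union => //; last by rewrite -eX; apply: thin_coPair.
rewrite disjoint_subset; apply/subsetP => y; rewrite !inE !negb_or => /andP[yZ _].
by rewrite (negPf yZ) andbF.
Qed.

(** * Trees of laminar families *)

Definition laminar (V : finType) (F : {set {set V}}) :=
  {in F &, forall X Y : {set V}, [|| X \subset Y, Y \subset X | [disjoint X & Y]]}.

(* P is the set of maximal proper subsets of X in F. *)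
Definition children (V : finType) (F P : {set {set V}}) (X : {set V}) :=
  [/\ partition P X, P \subset F &
      {in F, forall Y : {set V}, Y \proper X -> exists2 B, B \in P & Y \subset B}].

Section LaminarTree.
Variables (G : sgraph) (F : {set {set G}}).
Hypotheses (F0 : set0 \notin F) (lamF : laminar F) (FT : setT \in F)
  (F1 : forall x, [set x] \in F) (G2 : 1 < #|G|)
  (childF : forall X, X \in F -> 1 < #|X| ->
     exists2 P, children F P X & #|P| = 2 + (X == setT)).
Implicit Types X Y W : {set G}.

Definition covers X Y :=
  (X \proper Y) && [forall W in F, ~~ ((X \proper W) && (W \proper Y))].

Definition node := {X : {set G} | X \in F}.

Definition node_adj : rel node := fun a b =>
  covers (val a) (val b) || covers (val b) (val a).

Lemma node_adj_sym : symmetric node_adj.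
Proof. by move=> a b; rewrite /node_adj orbC. Qed.

Lemma node_adj_irrefl : irreflexive node_adj.
Proof. by move=> a; rewrite /node_adj orbb /covers properxx. Qed.

Definition laminar_tree := SGraph node_adj_sym node_adj_irrefl.

(** Both [Y] and [W] contain the nonempty [X], so laminarity makes them comparable, and nothing lies
    strictly between [X] and [Y]. *)
Lemma covers_sub X Y W : X \in F -> Y \in F -> W \in F ->
  covers X Y -> X \proper W -> Y \subset W.
Proof.
move=> XF YF WF /andP[XY /forall_inP cXY] XW.
case/or3P: (lamF YF WF) => // [WY|dis].
  case: (eqVneq W Y) => [->//|nWY].
  by have := cXY _ WF; rewrite XW properEneq nWY WY.
have /set0Pn[x xX] : X != set0 by apply: contraNneq F0 => <-.
have := disjointFr dis (subsetP (proper_sub XY) _ xX).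
by rewrite (subsetP (proper_sub XW) _ xX).
Qed.

Lemma covers_uniq X Y W : X \in F -> Y \in F -> W \in F ->
  covers X Y -> covers X W -> Y = W.
Proof.
move=> XF YF WF cY cW; apply/eqP; rewrite eqEsubset.
by rewrite (covers_sub XF YF WF) ?(covers_sub XF WF YF) //;
  [case/andP: cY | case/andP: cW].
Qed.

Lemma covers_ex X : X != setT -> exists2 Y, Y \in F & covers X Y.
Proof.
move=> XT.
have hT : (setT \in F) && (X \proper setT) by rewrite FT properT.
case: (arg_minnP (P := fun Y => (Y \in F) && (X \proper Y)) (fun Y => #|Y|) hT).
move=> Y /andP[YF XY] min; exists Y => //; rewrite /covers XY /=.
apply/forall_inP => W WF; apply/negP => /andP[XW WY].
by have := min W; rewrite WF XW => /(_ isT); rewrite leqNgt proper_card.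
Qed.

(** Having two blocks makes every block a proper subset of [X]; maximality then identifies the
    blocks with the lower covers. *)
Lemma covers_children P X Y : children F P X -> 1 < #|P| -> Y \in F ->
  covers Y X = (Y \in P).
Proof.
move=> [/and3P[/eqP cP tP P0] /subsetP PF maxP] P1 YF.
have sub B : B \in P -> B \subset X by move=> BP; rewrite -cP; apply: (bigcup_sup B).
have ne B : B \in P -> exists x, x \in B.
  by move=> BP; apply/set0Pn; apply: contraNneq P0 => <-.
have eqB B B' x : B \in P -> B' \in P -> x \in B -> x \in B' -> B = B'.
  move=> BP B'P xB xB'; apply/eqP/negPn/negP => nB.
  by have /trivIsetP/(_ _ _ BP B'P nB)/disjointFr/(_ xB) := tP; rewrite xB'.
have prop B : B \in P -> B \proper X.
  move=> BP; rewrite properEneq sub // andbT; apply/eqP => eB.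
  have [B' B'P nB'] : exists2 B', B' \in P & B' != B.
    case/card_gt1P: P1 => C [C' [CP C'P nC]].
    case: (eqVneq C B) => [e|]; last by exists C.
    by exists C' => //; rewrite -e eq_sym.
  have [x xB'] := ne _ B'P; case/eqP: nB'; apply: (eqB _ _ x) => //.
  by rewrite eB (subsetP (sub _ B'P)).
apply/idP/idP => [/andP[YX /forall_inP cYX] | YP].
  have [B BP YB] := maxP _ YF YX.
  case: (eqVneq Y B) => [->//|nYB].
  by have := cYX _ (PF _ BP); rewrite properEneq nYB YB prop.
rewrite /covers prop //=; apply/forall_inP => W WF; apply/negP => /andP[YW WX].
have [B BP WB] := maxP _ WF WX; have [x xY] := ne _ YP.
have xW := subsetP (proper_sub YW) _ xY.
have e := eqB _ _ _ YP BP xY (subsetP WB _ xW).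
by move: YW; rewrite e properE WB andbF.
Qed.

Lemma card_node_image (Q : pred {set G}) :
  #|[set b : node | Q (val b)]| = #|[set Y in F | Q Y]|.
Proof.
rewrite -(card_imset _ val_inj); apply: eq_card => Y.
apply/imsetP/idP => [[b + ->]|]; first by rewrite !inE (valP b).
by rewrite inE => /andP[YF QY]; exists (exist _ Y YF); rewrite ?inE.
Qed.

Lemma card_covering X : X \in F -> #|[set Y in F | covers X Y]| = (X != setT).
Proof.
move=> XF; case: (eqVneq X setT) => [->|XT] /=.
  by apply: eq_card0 => Y; rewrite !inE /covers properE subsetT !andbF.
have [Y YF cXY] := covers_ex XT.
apply/eqP/cards1P; exists Y; apply/setP => W; rewrite !inE.
apply/andP/eqP => [[WF cXW]|->//].
exact: covers_uniq cXW cXY.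
Qed.

Lemma card_covered X : X \in F ->
  #|[set Y in F | covers Y X]| = if #|X| == 1 then 0 else 2 + (X == setT).
Proof.
move=> XF; have X0 : 0 < #|X| by rewrite card_gt0; apply: contraNneq F0 => <-.
case: (eqVneq #|X| 1) => [X1|X1].
  apply: eq_card0 => Y; rewrite !inE; apply/negP => /and3P[YF /proper_card + _].
  rewrite X1 ltnS leqn0 cards_eq0 => /eqP Y0.
  by case/negP: F0; rewrite -Y0.
have [|P chP cP] := childF XF; first by lia.
rewrite -cP; apply: eq_card => Y; rewrite inE.
case: (boolP (Y \in F)) => YF /=; first by apply: covers_children => //; rewrite cP.
by apply/esym/negP => YP; case: chP => _ /subsetP/(_ _ YP); rewrite (negPf YF).
Qed.

(** An inner set has one upper and two lower covers. The full set has no upper cover, and the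
    summand [X == setT] in the hypothesis on children gives it a third lower one. A singleton has
    only its upper cover. *)
Lemma degree_node (a : laminar_tree) :
  degree a = if #|val a| == 1 then 1 else 3.
Proof.
rewrite /degree (card_node_image (fun Y => covers (val a) Y || covers Y (val a))).
have -> : [set Y in F | covers (val a) Y || covers Y (val a)] =
    [set Y in F | covers (val a) Y] :|: [set Y in F | covers Y (val a)].
  by apply/setP => Y; rewrite !inE andb_orr.
rewrite cardsU (_ : _ :&: _ = set0).
  rewrite card_covering ?card_covered ?(valP a) // cards0.
  case: (eqVneq #|val a| 1) => [a1|_].
    case: (eqVneq (val a) setT) => // e.
    by move: G2; rewrite -cardsT -e a1.
  by case: (val a == setT).
apply/setP => Y; rewrite !inE; apply/negP.
move=> /andP[/andP[_ /andP[/proper_card lt _]] /andP[_ /andP[/proper_card]]].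
lia.
Qed.

Lemma leaf_node (a : laminar_tree) : (a \in leaf laminar_tree) = (#|val a| == 1).
Proof. by rewrite inE degree_node; case: ifP. Qed.

Definition root_node : laminar_tree := exist _ setT FT.

Lemma connect_root (a : laminar_tree) : connect (@adj laminar_tree) a root_node.
Proof.
have [k] := ubnP #|~: val a|; elim: k => // k IH in a *; rewrite ltnS => ak.
case: (eqVneq (val a) setT) => [e|ne].
  by rewrite (_ : a = root_node) ?connect0 //; apply: val_inj.
have [Y YF cY] := covers_ex ne.
apply: (@connect_trans _ _ (exist _ Y YF : laminar_tree)).
  by apply: connect1; rewrite /adj /= /node_adj /= cY.
apply: IH; apply: leq_trans ak; apply: proper_card.
by rewrite properC; case/andP: cY.
Qed.

Lemma laminar_tree_cubic : cubic_tree laminar_tree.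
Proof.
have sym : connect_sym (@adj laminar_tree) by apply/sym_connect_sym/adj_sym.
split.
- split; first by apply/card_gt0P; exists root_node.
  move=> a b; apply: connect_trans (connect_root a) _.
  by rewrite sym connect_root.
- (* A smallest set on a cycle would have two distinct covers. *)
  move=> c; rewrite ltnNge => /andP[cyc unq]; apply/negP => c3.
  have [a0 a0c] : exists a, a \in c.
    by case: c c3 {cyc unq} => // a c; exists a; rewrite mem_head.
  case: (arg_minnP (P := mem c) (fun a : laminar_tree => #|val a|) a0c) => a ac min.
  have [i q eq] := rot_to ac.
  have up b : b \in c -> adj a b -> covers (val a) (val b).
    move=> bc /orP[//|/andP[/proper_card lt _]].
    by have := min b bc; rewrite leqNgt lt.
  move: cyc unq c3; rewrite -(rot_cycle i) -(rot_uniq i) -(size_rot i) eq.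
  have mc b : b \in a :: q -> b \in c by rewrite -eq mem_rot.
  case: q {eq} mc => [|b q] mc //=; rewrite rcons_path => /and3P[aab _ laa].
  case/and3P=> _ nbq _ q3.
  have eb : b = last b q.
    apply: val_inj; apply: (covers_uniq (valP a) (valP b) (valP _)).
      by apply: up => //; apply: mc; rewrite !inE eqxx orbT.
    apply: up; last by rewrite adj_sym.
    by apply: mc; rewrite inE mem_last orbT.
  by case: q nbq q3 eb {laa mc} => // d q nbq _ eb; rewrite {1}eb /= mem_last in nbq.
- by move=> a; rewrite leaf_node degree_node => /negPf ->.
Qed.

Lemma default_vertex : G.
Proof. by case: (pickP G) => // G0; have := eq_card0 G0; move: G2 => /[swap] ->. Qed.

Definition leaf_vertex (l : {a : laminar_tree | a \in leaf laminar_tree}) : G :=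
  odflt default_vertex [pick x in val (val l)].

Lemma leaf_vertexP l : val (val l) = [set leaf_vertex l].
Proof.
have := valP l; rewrite leaf_node /leaf_vertex => /cards1P[x ->].
by case: pickP => [y /set1P-> //|/(_ x)]; rewrite set11.
Qed.

Lemma singleton_leaf x :
  (exist _ [set x] (F1 x) : laminar_tree) \in leaf laminar_tree.
Proof. by rewrite leaf_node cards1. Qed.

Lemma leaf_vertex_bij : bijective leaf_vertex.
Proof.
exists (fun x => exist (fun a => a \in leaf laminar_tree) _ (singleton_leaf x)) => [l|x].
  by apply: val_inj; apply: val_inj; rewrite /= -leaf_vertexP.
by apply/esym/set1P; rewrite -leaf_vertexP set11.
Qed.

Definition laminar_decomposition : pm_decomposition G :=
  PMDecomposition laminar_tree_cubic leaf_vertex_bij.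

Local Notation D := laminar_decomposition.

(** A path from [a] leaves the subsets of [a] only by climbing from [a] to its unique cover [b], and
    that edge is removed. Conversely, a member inside [a] reaches [a] by climbing through covers. *)
Lemma mem_side_covers (a b c : tree D) : covers (val a) (val b) ->
  (c \in side a b) = (val c \subset val a).
Proof.
move=> cab; rewrite inE; apply/idP/idP => [/connectP[p + ->]|].
  elim/last_ind: p => [|p d IH]; first by rewrite subxx.
  rewrite rcons_path last_rcons => /andP[/IH]; set w := last a p => wa.
  case/andP=> /orP[cwd|/andP[/proper_sub dw _] _]; last exact: subset_trans wa.
  case: (eqVneq w a) => [e|nwa].
    rewrite e in cwd *; have -> : d = b.
      by apply: val_inj; apply: (covers_uniq (valP a) (valP d) (valP b)).
    by rewrite eqxx.
  move=> _; apply: (covers_sub (valP w) (valP d) (valP a) cwd).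
  by rewrite properEneq wa andbT; apply: contraNneq nwa => /val_inj ->.
have [k] := ubnP #|val a :\: val c|; elim: k => // k IH in c *; rewrite ltnS => ck ca.
case: (eqVneq c a) => [->|nca]; first exact: connect0.
have cpa : val c \proper val a.
  by rewrite properEneq ca andbT; apply: contraNneq nca => /val_inj ->.
have cT : val c != setT.
  by apply: contraTneq cpa => ->; rewrite properE subsetT andbF.
have [Y YF cY] := covers_ex cT; pose d : tree D := exist _ Y YF.
have da : val d \subset val a by apply: (covers_sub (valP c) (valP d) (valP a)).
apply: (@connect_trans _ _ d).
  apply: IH => //; apply: leq_trans ck; apply: proper_card.
  case/andP: (cY) => /properP[cd [x xd xc]] _; apply/properP; split; first exact: setDS.
  by exists x; rewrite !inE ?xc ?xd ?(subsetP da).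
apply: connect1; rewrite /tree_minus /adj /= /node_adj /= cY orbT /=.
have nb (e : tree D) : val e \subset val a -> e != b.
  move=> ea; apply: contraTneq ea => ->; case/andP: cab => /properP[_ [x xb xa]] _.
  by apply/subsetPn; exists x.
by apply/eqP => /set2_eq[] [e1 e2]; [have := nb c ca|have := nb d da];
  rewrite ?e1 ?e2 eqxx.
Qed.

Lemma shore_covers (a b : tree D) : covers (val a) (val b) -> shore a b = val a.
Proof.
move=> cab; apply/setP => x; have [l ->] := delta_surj D x.
by rewrite mem_shore mem_side_covers // leaf_vertexP sub1set.
Qed.

Lemma adj_shore (a b : tree D) : adj a b ->
  shore a b = val a \/ shore a b = ~: val b.
Proof.
move=> aab; case/orP: (aab) => cab; first by left; apply: shore_covers.
by right; rewrite shoreC ?shore_covers // adj_sym.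
Qed.

Lemma laminar_width k : {in F, forall X, porosity X <= k} -> width D <= k.
Proof.
move=> pF; apply/bigmax_leqP => -[a b] /= /adj_shore.
case=> ->; first exact: pF (valP a).
have /porosity_leqP pb := pF _ (valP b).
by apply/porosity_leqP => m mm; rewrite card_crossingC // pb.
Qed.

Lemma laminar_M_decomposition m : matching m ->
  {in F, forall X, 1 < #|X| -> stable m X} -> M_decomposition D (matching_edges m).
Proof.
move=> mm sF.
have sN (a : tree D) : a \notin leaf _ -> stable m (val a).
  move=> nla; apply: sF (valP a) _; rewrite leaf_node in nla.
  by rewrite ltn_neqAle eq_sym nla card_gt0; apply: contraNneq F0 => <-; apply: valP.
have conf (a b : tree D) : adj a b -> a \notin leaf _ -> b \notin leaf _ ->
    conformal (matching_edges m) (shore a b).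
  move=> aab nla nlb; apply/(conformalP _ mm).
  by case: (adj_shore aab) => ->; [apply: sN | apply/stableC/sN].
by move=> a b aab nla nlb; split; apply: conf; rewrite // adj_sym.
Qed.

End LaminarTree.

(** * Laminar families of assembled sets *)

Section Forest.
Variables (G : sgraph) (m : G -> G).
Implicit Types (F P : {set {set G}}) (X Y : {set G}).

(** [X] need not belong to [F], so that disjoint families can be united first and a top set added
    afterwards. *)
Record forest F X : Prop := Forest {
  forest0 : set0 \notin F;
  forest_sub : {in F, forall Y, Y \subset X};
  forest_lam : laminar F;
  forest1 : forall x, x \in X -> [set x] \in F;
  forest_good : {in F, forall Y, 1 < #|Y| -> stable m Y /\ thin Y};
  forest_child : {in F, forall Y, 1 < #|Y| ->
    exists2 P, children F P Y & #|P| = 2} }.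

Lemma forest_single x : forest [set [set x]] [set x].
Proof.
split=> [|Y /set1P -> //|Y W /set1P-> /set1P-> |y /set1P-> |Y /set1P->|Y /set1P->].
- by rewrite inE eq_sym -cards_eq0 cards1.
- by rewrite subxx.
- by rewrite set11.
- by rewrite cards1.
- by rewrite cards1.
Qed.

Lemma forest_union F1 F2 X1 X2 : [disjoint X1 & X2] ->
  forest F1 X1 -> forest F2 X2 -> forest (F1 :|: F2) (X1 :|: X2).
Proof.
move=> dX f1 f2.
have ext (Fa Fb : {set {set G}}) (Xa Xb : {set G}) Y :
    [disjoint Xa & Xb] -> forest Fa Xa -> forest Fb Xb ->
    Y \in Fa -> 1 < #|Y| -> exists2 P, children (Fa :|: Fb) P Y & #|P| = 2.
  move=> dab fa fb YF Y1; have [P [pP PF maxP] cP] := forest_child fa YF Y1.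
  exists P => //; split=> //; first by rewrite subsetU ?PF.
  move=> W; rewrite inE => /orP[]; first exact: maxP.
  move=> WF WY; have /set0Pn[x xW] : W != set0.
    by apply: contraNneq (forest0 fb) => <-.
  have xa := subsetP (forest_sub fa YF) _ (subsetP (proper_sub WY) _ xW).
  by have := subsetP (forest_sub fb WF) _ xW; rewrite (disjointFr dab xa).
have dis Y W : Y \in F1 -> W \in F2 -> [disjoint Y & W].
  move=> /(forest_sub f1) YX /(forest_sub f2) WX.
  exact: disjointWl YX (disjointWr WX dX).
split.
- by rewrite inE negb_or (forest0 f1) (forest0 f2).
- move=> Y; rewrite inE => /orP[/(forest_sub f1)|/(forest_sub f2)] YX.
    by rewrite subsetU ?YX.
  by rewrite subsetU ?YX ?orbT.
- move=> Y W; rewrite !inE => /orP[]YF /orP[]WF.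
  + exact: forest_lam f1 _ _ YF WF.
  + by rewrite dis ?orbT.
  + by rewrite disjoint_sym dis ?orbT.
  + exact: forest_lam f2 _ _ YF WF.
- by move=> x; rewrite !inE => /orP[/(forest1 f1)|/(forest1 f2)] ->; rewrite ?orbT.
- by move=> Y; rewrite inE => /orP[/(forest_good f1)|/(forest_good f2)].
- move=> Y; rewrite inE => /orP[] YF Y1; first exact: ext dX f1 f2 YF Y1.
  rewrite setUC; apply: ext f2 f1 YF Y1; by rewrite disjoint_sym.
Qed.

Lemma children_add F P X Y : children F P Y -> Y \subset X ->
  children (X |: F) P Y.
Proof.
move=> [pP PF maxP] YX; split=> //; first by rewrite subsetU ?PF ?orbT.
move=> W; rewrite !inE => /orP[/eqP->|]; last exact: maxP.
by rewrite properE YX andbF.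
Qed.

Lemma laminar_add F X : laminar F -> {in F, forall Y, Y \subset X} ->
  laminar (X |: F).
Proof.
move=> lF sF Y W; rewrite !inE => /orP[/eqP->|YF] /orP[/eqP->|WF].
- by rewrite subxx.
- by rewrite (sF _ WF) orbT.
- by rewrite (sF _ YF).
- exact: lF.
Qed.

Lemma children_top F P X : partition P X -> P \subset F ->
  {in F, forall Y, exists2 B, B \in P & Y \subset B} ->
  children (X |: F) P X.
Proof.
move=> pP PF maxP; split=> //; first by rewrite subsetU ?PF ?orbT.
move=> Y; rewrite !inE => /orP[/eqP->|YF _]; last exact: maxP.
by rewrite properxx.
Qed.

Lemma forest_join F1 F2 X1 X2 : [disjoint X1 & X2] ->
  forest F1 X1 -> forest F2 X2 -> X1 \in F1 -> X2 \in F2 ->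
  stable m (X1 :|: X2) -> thin (X1 :|: X2) ->
  forest ((X1 :|: X2) |: (F1 :|: F2)) (X1 :|: X2).
Proof.
move=> dX f1 f2 X1F X2F sX tX; have f := forest_union dX f1 f2.
have X10 : X1 != set0 by apply: contraNneq (forest0 f1) => <-.
have X20 : X2 != set0 by apply: contraNneq (forest0 f2) => <-.
have X12 : X1 != X2.
  by apply: contraTneq dX => ->; rewrite -setI_eq0 setIid.
split.
- rewrite !inE negb_or -in_setU (forest0 f) andbT eq_sym setU_eq0.
  by rewrite negb_and X10.
- move=> Y; rewrite in_setU1 => /orP[/eqP->//|]; exact: forest_sub f _.
- exact: laminar_add (forest_lam f) (forest_sub f).
- by move=> x xX; rewrite in_setU1 (forest1 f) ?orbT.
- by move=> Y; rewrite in_setU1 => /orP[/eqP->|] //; apply: forest_good f _.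
move=> Y; rewrite in_setU1 => /orP[/eqP-> _ {Y}|YF Y1]; last first.
  have [P cP P2] := forest_child f YF Y1; exists P => //.
  exact: children_add cP (forest_sub f YF).
exists [set X1; X2]; last by rewrite cards2 X12.
apply: children_top.
- apply/and3P; split.
  + by rewrite /cover big_setU1 ?big_set1 // inE.
  + apply/trivIsetP => U W; rewrite !inE => /orP[] /eqP-> /orP[] /eqP->;
      rewrite ?eqxx // => _; by rewrite disjoint_sym.
  + by rewrite !inE negb_or ![set0 == _]eq_sym X10.
- by rewrite subUset !sub1set !inE X1F X2F orbT.
move=> W; rewrite inE => /orP[/(forest_sub f1)|/(forest_sub f2)] WX.
  by exists X1; rewrite ?set21.
by exists X2; rewrite ?set22.
Qed.

Hypothesis mm : matching m.

Lemma assembled_stable X : assembled m X -> stable m X.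
Proof.
elim=> [x|Y W _ sY _ sW _ _]; first exact: stable_pair.
exact: stableU.
Qed.

Lemma assembled_forest X : assembled m X -> exists2 F, forest F X & X \in F.
Proof.
elim=> {X} [x|X Y aX [F fF XF] aY [F' fF' YF] dXY tXY].
  exists ([set x; m x] |: ([set [set x]] :|: [set [set m x]])); last by rewrite setU11.
  apply: forest_join; rewrite ?set11 //; try exact: forest_single.
  - by rewrite disjoints1 inE eq_sym (matching_neq _ mm).
  - exact: stable_pair.
  - by apply: thin_small; rewrite cards2; case: eqP.
exists ((X :|: Y) |: (F :|: F')); last by rewrite setU11.
by apply: forest_join => //; apply: stableU; apply: assembled_stable.
Qed.

(** The full set is put on top with three children, [[set x]], [[set m x]] and the assembled
    complement, which gives the root degree three. *)
Lemma assembled_decomposition x : 2 < #|G| -> assembled m (~: [set x; m x]) ->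
  exists2 D : pm_decomposition G, M_decomposition D (matching_edges m) & width D <= 2.
Proof.
move=> G3 asm; pose X := ~: [set x; m x].
have [F fF XF] := assembled_forest asm.
have xm : x != m x by rewrite eq_sym (matching_neq _ mm).
have cX : 2 + #|X| = #|G| by rewrite -(cardsC [set x; m x]) cards2 xm.
have d1 : [disjoint [set x] & [set m x]] by rewrite disjoints1 inE.
have d2 : [disjoint [set x] :|: [set m x] & X] by rewrite disjoints_subset setCK.
have f12 := forest_union d1 (forest_single x) (forest_single (m x)).
have := forest_union d2 f12 fF; rewrite setUCr.
set F' := _ :|: F => f'.
have TF' : setT \notin F'.
  rewrite /F' !inE negb_or; apply/andP; split.
    apply/negP => /orP[] /eqP e; move: G3; rewrite -cardsT e cards1 //.
  apply/negP => /(forest_sub fF) /subset_leq_card; rewrite cardsT -/X; lia.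
have X0 : X != set0 by apply: contraNneq (forest0 fF) => <-.
pose P : {set {set G}} := X |: [set [set x]; [set m x]].
have cP : #|P| = 3.
  rewrite cardsU1 cards2 (inj_eq set1_inj) xm !inE.
  have nX y : y \in [set x; m x] -> (X == [set y]) = false.
    move=> yX; apply/eqP => e; have := set11 y; rewrite -e inE yX //.
  by rewrite !nX ?set21 ?set22.
have chT : children (setT |: F') P setT.
  apply: children_top.
  - apply/and3P; split.
    + rewrite /cover big_setU1 /=; last first.
        move: cP; rewrite cardsU1 cards2; case: (X \notin _) => //.
        by case: (_ != _).
      rewrite big_setU1 ?big_set1 ?inE ?(inj_eq set1_inj) //=.
      by rewrite setUC setUCr.
    + have dX y : y \in [set x; m x] -> [disjoint X & [set y]].
        by move=> yX; rewrite disjoint_sym disjoints1 inE negbK.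
      have dx := dX _ (set21 _ _); have dmx := dX _ (set22 _ _).
      apply/trivIsetP => Y W; rewrite !inE.
      move=> /orP[/eqP->|/orP[]/eqP->] /orP[/eqP->|/orP[]/eqP->]; rewrite ?eqxx // => _;
        by rewrite disjoint_sym.
    + rewrite !inE !negb_or ![set0 == _]eq_sym X0 -!cards_eq0 !cards1 //.
  - apply/subsetP => Y; rewrite !inE => /orP[/eqP->|->] //.
    by rewrite XF orbT.
  move=> Y; rewrite !inE => /orP[/orP[]/eqP->|/(forest_sub fF) YX].
  - by exists [set x]; rewrite ?inE ?eqxx ?orbT.
  - by exists [set m x]; rewrite ?inE ?eqxx ?orbT.
  - by exists X; rewrite ?inE ?eqxx.
have H0 : set0 \notin setT |: F'.
  rewrite in_setU1 negb_or (forest0 f') andbT eq_sym -card_gt0 cardsT; lia.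
have HL := laminar_add (forest_lam f') (forest_sub f').
have H1 y : [set y] \in setT |: F' by rewrite in_setU1 (forest1 f') ?orbT.
have HC Y : Y \in setT |: F' -> 1 < #|Y| ->
    exists2 P, children (setT |: F') P Y & #|P| = 2 + (Y == setT).
  rewrite in_setU1 => /orP[/eqP-> _|YF Y1]; first by exists P; rewrite // eqxx.
  have [Q cQ Q2] := forest_child f' YF Y1; exists Q; first exact: children_add.
  by case: eqP YF TF' => [->->|].
exists (laminar_decomposition H0 HL (setU11 _ _) H1 (ltnW G3) HC).
  apply: laminar_M_decomposition => // Y; rewrite in_setU1 => /orP[/eqP-> _ y|YF Y1].
    by rewrite !inE.
  by case: (forest_good f' YF Y1).
apply: laminar_width => Y YF; apply/porosity_leqP => m' mm'.
case: (ltnP 1 #|Y|) => Y1; last first.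
  by apply: leq_trans (card_crossing_leq _ _) _; lia.
move: YF; rewrite in_setU1 => /orP[/eqP->|YF].
  by rewrite stable_crossing ?cards0 // => y; rewrite !inE.
by have [_] := forest_good f' YF Y1; apply.
Qed.

End Forest.

(** * The equivalence *)

(** Both contractions of a tight cut inherit all hypotheses. [A] is quantified inside because the
    colour class changes with each contraction. *)
Lemma splittable_braces (G H : sgraph) : brace_of G H ->
  forall A : {set G}, 2 < #|G| -> connected G -> edge_covered G -> coloring A ->
  splittable G -> isomorphic H C4 \/ isomorphic H K33.
Proof.
have step (K : sgraph) (Z A : {set K}) : nontrivial Z -> tight Z ->
    2 < #|K| -> connected K -> edge_covered K -> coloring A -> splittable K ->
    [/\ 2 < #|contraction Z|, connected (contraction Z),
        edge_covered (contraction Z), coloring (proj_color Z A) &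
        splittable (contraction Z)].
  move=> nZ tZ K3 con ec cA sp; have /andP[Z3 _] := nontrivial_contraction nZ.
  have Z0 : exists z, z \in Z by case: nZ => Z1 _; apply/card_gt0P/ltnW.
  split=> //; [exact: contraction_connected | exact: contraction_covered
    | exact: contraction_coloring | exact: splittable_contraction cA tZ sp].
elim=> {G H} [G _ noG|G H Z nZ tZ _ IH|G H Z nZ tZ _ IH] A G3 con ec cA sp.
- exact: splittable_brace cA noG sp.
- by have [*] := step _ _ _ nZ tZ G3 con ec cA sp; apply: IH; eassumption.
- have [*] := step _ _ _ (nontrivialC nZ) (tightC tZ) G3 con ec cA sp.
  by apply: IH; eassumption.
Qed.

(** One of the two shores has at most one vertex. This excludes graphs on two vertices once the
    width is known to be two. *)
Lemma width_card2 (G : sgraph) (D : pm_decomposition G) : #|G| <= 2 -> width D <= 1.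
Proof.
move=> G2; apply/bigmax_leqP => -[t1 t2] _ /=; set X := shore _ _.
apply/porosity_leqP => m mm.
case: (leqP #|X| 1) => [|X2]; first exact: leq_trans (card_crossing_leq _ _).
rewrite -card_crossingC //; apply: leq_trans (card_crossing_leq _ _) _.
have := cardsC X; lia.
Qed.

Theorem theorem11 (G : sgraph) (A B : {set G}) :
  1 < #|G| -> bipartition A B -> matching_covered G ->
  [<-> exists2 M, M \in perfect_matchings G & M_pmw_eq M 2;
       forall M, M \in perfect_matchings G -> M_pmw_eq M 2;
       forall H, brace_of G H -> isomorphic H C4 \/ isomorphic H K33].
Proof.
move=> G2 bip [con mc].
have cA : coloring A.
  case: bip => AB dAB col x y axy.
  have : y \in A :|: B by rewrite AB inE.
  rewrite (col _ _ axy) inE.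
  by case: (boolP (y \in A)) => [/(disjointFr dAB) -> | _ /= ->].
have ec : edge_covered G.
  move=> x y; rewrite -edgesP => /mc[M /pm_matching[m mm ->]].
  move=> /(conj (set21 x y))/andP; rewrite andbC edge_of_matching //.
  move=> /eqP/set2_eq[[_ ->]|[e _]]; first by exists m.
  by have := matching_neq x mm; rewrite -e eqxx.
have braces_of_width : (exists2 M, M \in perfect_matchings G & M_pmw_eq M 2) ->
    forall H, brace_of G H -> isomorphic H C4 \/ isomorphic H K33.
  move=> [M /pm_matching[m mm ->] [[D MD wD] _]] H GH.
  apply: (splittable_braces GH _ con ec cA).
    by rewrite ltnNge; apply/negP => /(width_card2 D); rewrite wD.
  by apply: decomposition_splittable mm MD _; rewrite wD.
have width_of_braces : (forall H, brace_of G H -> isomorphic H C4 \/ isomorphic H K33) ->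
    forall M, M \in perfect_matchings G -> M_pmw_eq M 2.
  move=> br M /pm_matching[m mm ->].
  have cAC := card_coloring mm cA; have cG := cardsC A.
  have G4 : 3 < #|G|.
    (* The number of vertices is even, so only two has to be excluded; a graph on two vertices would
       be its own brace, of the wrong size. *)
    suff : #|G| != 2 by lia.
    apply/eqP => G2'; have /br : brace_of G G.
      apply: brace_of_self; first by exists A, B.
      move=> Z [Z1 Z2]; have := cardsC Z; lia.
    by case=> -[f /bij_eq_card]; rewrite G2' ?card_prod ?card_bool card_ord.
  have lower D : M_decomposition D (matching_edges m) -> 2 <= width D.
    exact: width_ge2 G4 con ec cA mm.
  split=> //.
  have /card_gt1P[x _] := G2.
  have asm := assembled_of_braces (ltnW G4) con ec cA br x mm.
  have [D MD wD] := assembled_decomposition mm (ltnW G4) asm.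
  by exists D => //; apply/eqP; rewrite eqn_leq wD lower.
(* Passing from all matchings to some requires one perfect matching, obtained from any edge. *)
tfae.
- by move=> /braces_of_width/width_of_braces.
- move=> all2; apply: braces_of_width.
  have [m mm] := connected_matching G2 con ec.
  by exists (matching_edges m); [exact: matching_edges_pm | apply/all2/matching_edges_pm].
- move/width_of_braces => all2; have [m mm] := connected_matching G2 con ec.
  by exists (matching_edges m); [exact: matching_edges_pm | apply/all2/matching_edges_pm].
Qed.
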